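(* Let $m\ge 1$ and, for $i=1,\ldots,m$, let $\{X^{(i)}_j\}_{j\ge 0}$ be real random variables such that the families for different $i$ are independent of each other, and each family satisfies: $\{X^{(i)}_j\}_{j\ge0}$ are independent, $\mathrm{E}(X^{(i)}_j)=0$, $\mathrm{E}((X^{(i)}_j)^2)=1$ for all $j\ge0$, and $\sup_{j\ge0}\mathrm{E}(|X^{(i)}_j|^k)<\infty$ for every $k\ge3$. For each $n$ and $i$, let $RC^{(i)}_n$ be the $n\times n$ reverse circulant matrix whose $(r,s)$-th entry is $X^{(i)}_k/\sqrt n$, where $k\in\{1,\ldots,n\}$ satisfies $k\equiv r+s-1\pmod n$. Let $\{\eta_i\}_{1\le i\le m}$ be independent complex standard Gaussian random variables and define the $2\times 2$ random matrices $$a_i=\begin{pmatrix}0&\eta_i\\ \overline{\eta_i}&0\end{pmatrix},\qquad i=1,\ldots,m.$$ Then, as elements of the non-commutative probability space $(\mathcal M_n,\phi_n)$, $\{RC^{(i)}_n\}_{1\le i\le m}$ converges jointly to $\{a_i\}_{1\le i\le m}\subset(\mathcal M_2,\phi_2)$; that is, for every complex polynomial $Q$ in $m$ non-commuting variables, $$\phi_n\big(Q(RC^{(1)}_n,\ldots,RC^{(m)}_n)\big)\to \phi_2\big(Q(a_1,\ldots,a_m)\big)\quad\text{as } n\to\infty.$$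
   Context: $\mathcal M_n$ denotes the algebra of $n\times n$ random matrices whose entries have finite moments of all orders, and $\phi_n(A)=\frac1n\mathrm{E}[\mathrm{Tr}(A)]$; $(\mathcal M_n,\phi_n)$ is a non-commutative probability space (a unital complex algebra with a linear functional $\phi_n$ satisfying $\phi_n(I)=1$). A complex standard Gaussian variable $\eta$ satisfies $\mathrm{E}|\eta|^2=1$ (so $\mathrm{E}|\eta|^{2s}=s!$). *)

(* Defs.v *)
From HB Require Import structures.
From mathcomp Require Import all_boot all_order all_algebra.
From mathcomp Require Import complex.
From mathcomp Require Import finmap.
From mathcomp Require Import all_classical all_reals all_analysis.

Set Implicit Arguments.
Unset Strict Implicit.
Unset Printing Implicit Defensive.

Import Order.TTheory GRing.Theory Num.Theory.
Import numFieldNormedType.Exports.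

Local Open Scope classical_set_scope.
Local Open Scope ring_scope.

Section Defs.
Context {R : realType} {d : measure_display} {T : measurableType d}.
Variable P : probability T R.

Definition indep_sets {I : choiceType} (F : I -> set (set T)) : Prop :=
  forall (J : {fset I}) (A : I -> set T),
    (forall i, i \in J -> F i (A i)) ->
    P (\bigcap_(i in [set` J]) A i) = (\prod_(i <- J) P (A i))%E.

Definition sigma_RVs {J : Type} (Y : J -> T -> R) : set (set T) :=
  <<s [set A | exists j B, measurable B /\ A = Y j @^-1` B] >>.

Definition indep_RVs {I : choiceType} (Y : I -> T -> R) : Prop :=
  indep_sets (fun i => sigma_RVs (fun _ : unit => Y i)).

Definition indep_families {I : choiceType} {J : Type} (Y : I -> J -> T -> R)
  : Prop := indep_sets (fun i => sigma_RVs (Y i)).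

Definition Ec (f : T -> R[i]) : R[i] :=
  ((fine 'E_P[fun w => complex.Re (f w)])%:C + 'i * (fine 'E_P[fun w => complex.Im (f w)])%:C)%C.

Definition phi (k : nat) (A : T -> 'M[R[i]]_k) : R[i] :=
  (k%:R)^-1 * Ec (fun w => \tr (A w)).

End Defs.

(** Polynomials in m non-commuting variables with complex coefficients,
    represented as finite formal sums of (coefficient, word) pairs. *)
Definition ncpoly (R : realType) (m : nat) := seq (R[i] * seq 'I_m).

Definition nceval {R : realType} {m k : nat} (Q : ncpoly R m)
  (A : 'I_m -> 'M[R[i]]_k) : 'M[R[i]]_k :=
  \sum_(t <- Q) t.1 *: foldr (fun i M => A i *m M) 1%:M t.2.

Definition nceval_rand {R : realType} {d} {T : measurableType d} {m k : nat}
  (Q : ncpoly R m) (A : 'I_m -> T -> 'M[R[i]]_k) : T -> 'M[R[i]]_k :=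
  fun w => nceval Q (fun i => A i w).

(** reverse circulant index: with 0-based row r and column s (so the paper's
    indices are r+1, s+1), the unique k in {1,..,n} with
    k = (r+1)+(s+1)-1 = r+s+1 mod n. *)
Definition rc_index (n : nat) (r s : 'I_n) : nat :=
  let t := ((r + s + 1) %% n)%N in if t == 0%N then n else t.

Definition RCmat {R : realType} {d} {T : measurableType d}
  (X : nat -> T -> R) (n : nat) : T -> 'M[R[i]]_n :=
  fun w => \matrix_(r < n, s < n)
             ((X (rc_index r s) w / Num.sqrt (n%:R))%:C)%C.

Definition amat {R : realType} {d} {T : measurableType d}
  (eta : T -> R[i]) : T -> 'M[R[i]]_2 :=
  fun w => \matrix_(r < 2, s < 2)
             (if r == s then 0 else if r == ord0 then eta w else conjc (eta w)).

Definition cvgC {R : realType} (u : nat -> R[i]) (l : R[i]) : Prop :=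
  (fun n => Normc.normc (u n - l)) @ \oo --> (0 : R).

(* Main.v *)
(** A reverse circulant matrix exchanges the Fourier vectors of [y] and [y^-1],
    for [y] an [n]-th root of unity: it sends the row [(y^r)_r] to
    [D y *: (y^-r)_r], where [D y] is the normalized sum of the [y^k X_k].
    Tracing a word over the Fourier vectors, its normalized expected trace is
    the average over [y] of [E (D_i1 y * D_i2 y^-1 * D_i3 y * ...)], only the
    [y] with [y^2 = 1] contributing when the word has odd length.  The matrix
    [a_i] acts in the same way on the two basis vectors of the plane, with
    [eta_i] and its conjugate as coefficients.

    The limit of [E (D_i1 y * D_i2 y^-1 * ...)] comes from an approximate Wick
    formula.  Expand the product over index words.  The first letter must occur
    again; if it occurs exactly twice, independence pairs it off with variance 1,
    and all the other words which contribute have every multiplicity at least 2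
    and one at least 3, so that they are too few to matter: their total weight
    is O(1/sqrt n).  Contracting [D y] with [D y'] gives the mean of
    [(y y')^k] over [k], which for [y^2 <> 1] is 1 if [y' = y^-1] and 0
    if [y' = y].  For Gaussian variables integration by parts makes the formula
    exact, with the same contractions for [eta_i] and its conjugate, hence the
    same recursion on words.  The at most two [y] with [y^2 = 1] carry bounded
    terms and disappear in the average. *)
Require Import Defs.
From HB Require Import structures.
From mathcomp Require Import all_boot all_order all_algebra.
From mathcomp Require Import complex.
From mathcomp Require Import finmap.
From mathcomp Require Import all_classical all_reals all_analysis.
From mathcomp Require Import measurable_realfun separable cyclotomic ring lra.

Set Implicit Arguments.
Unset Strict Implicit.
Unset Printing Implicit Defensive.

Import Order.TTheory GRing.Theory Num.Theory.
Import numFieldNormedType.Exports.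
Local Open Scope classical_set_scope.
Local Open Scope ring_scope.

(** * Product expectations under independence *)

Section WeightedImages.
Import HBSimple HBNNSimple.
Context (R : realType) d1 (T1 : measurableType d1) d2 (T2 : measurableType d2)
  d (S : measurableType d).
Variables (mu1 : {measure set T1 -> \bar R}) (mu2 : {measure set T2 -> \bar R}).
Variables (h1 : T1 -> R) (h2 : T2 -> R) (Y1 : T1 -> S) (Y2 : T2 -> S).
Hypothesis ih1 : mu1.-integrable setT (EFin \o h1).
Hypothesis ih2 : mu2.-integrable setT (EFin \o h2).
Hypothesis mY1 : measurable_fun setT Y1.
Hypothesis mY2 : measurable_fun setT Y2.
Hypothesis h12 : forall B, measurable B ->
  (\int[mu1]_x (h1 x * \1_B (Y1 x))%:E = \int[mu2]_x (h2 x * \1_B (Y2 x))%:E)%E.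

Let integrable_indicM {d'} {T : measurableType d'} (mu : {measure set T -> \bar R})
    (h : T -> R) (Y : T -> S) (B : set S) :
  mu.-integrable setT (EFin \o h) -> measurable_fun setT Y -> measurable B ->
  mu.-integrable setT (fun x => (h x * \1_B (Y x))%:E).
Proof.
move=> ih mY mB; apply: (le_integrable measurableT _ _ ih) => /=.
  apply/measurable_EFinP/measurable_funM.
    by case/integrableP: ih => /measurable_EFinP.
  exact: measurableT_comp.
move=> x _; rewrite lee_fin normrM ler_piMr// ger0_norm//.
Qed.

(* The weights allow [h1] to be a signed product of the other variables, and
   [h2] a constant (independence) or a density (change of measure). *)
Lemma integral_weighted_nnsfun (f : {nnsfun S >-> R}) :
  (\int[mu1]_x (h1 x * f (Y1 x))%:E = \int[mu2]_x (h2 x * f (Y2 x))%:E)%E.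
Proof.
have mf z : measurable (f @^-1` [set z]) by exact: measurable_funPTI.
pose s := fset_set (f @` setT).
have E d' (T : measurableType d') (mu : {measure set T -> \bar R}) (h : T -> R)
    (Y : T -> S) : mu.-integrable setT (EFin \o h) -> measurable_fun setT Y ->
  (\int[mu]_x (h x * f (Y x))%:E = \sum_(i < #|` s|)
     (s`_i)%:E * \int[mu]_x (h x * \1_(f @^-1` [set s`_i]) (Y x))%:E)%E.
  move=> ih mY.
  under eq_integral => x _.
    rewrite (fimfunEord f (Y x)) mulr_sumr -sumEFin.
    under eq_bigr => i _ do rewrite mulrCA EFinM.
    over.
  rewrite integral_sum//.
    apply: eq_bigr => i _; rewrite integralZl//; exact: integrable_indicM.
  move=> i; apply: integrableZl => //; exact: integrable_indicM.
by rewrite !E//; apply: eq_bigr => i _; rewrite h12.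
Qed.

(** Monotone convergence along simple functions increasing to [f]; the weights are nonnegative to
    keep the integrands monotone. No integrability of the products is asked, so absolute moments can
    be bounded by this form. *)
Lemma ge0_integral_weighted (f : S -> R) : measurable_fun setT f ->
  (forall x, 0 <= f x) -> (forall x, 0 <= h1 x) -> (forall x, 0 <= h2 x) ->
  (\int[mu1]_x (h1 x * f (Y1 x))%:E = \int[mu2]_x (h2 x * f (Y2 x))%:E)%E.
Proof.
move=> mf f0 h10 h20.
pose mF : measurable_fun setT (EFin \o f) := (measurable_EFinP _ _).2 mf.
pose f_ n := nnsfun_approx measurableT mF n.
have E d' (T : measurableType d') (mu : {measure set T -> \bar R}) (h : T -> R)
    (Y : T -> S) : mu.-integrable setT (EFin \o h) -> measurable_fun setT Y ->
    (forall x, 0 <= h x) ->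
  (\int[mu]_x (h x * f_ n (Y x))%:E @[n --> \oo] -->
     \int[mu]_x (h x * f (Y x))%:E)%E.
  move=> ih mY h0.
  have fcvg x : (h x * f_ n (Y x))%:E @[n --> \oo] --> (h x * f (Y x))%:E.
    under eq_fun do rewrite EFinM.
    rewrite EFinM; apply: cvgeZl => //.
    exact: (cvg_nnsfun_approx measurableT mF (fun x _ => f0 x)).
  rewrite [X in _ --> X](_ : _ =
    \int[mu]_x limn (fun n => (h x * f_ n (Y x))%:E))%E; last first.
    by apply: eq_integral => x _; apply/esym/cvg_lim.
  apply: cvg_monotone_convergence => //.
  - move=> n; apply/measurable_EFinP/measurable_funM.
      by case/integrableP: ih => /measurable_EFinP.
    exact: measurableT_comp.
  - by move=> n x _; rewrite lee_fin mulr_ge0.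
  - move=> x _ m n mn; rewrite lee_fin ler_wpM2l//.
    have /lefP := nd_nnsfun_approx measurableT mF mn; exact.
have := E _ _ _ _ _ ih1 mY1 h10.
under eq_fun do rewrite integral_weighted_nnsfun.
by move=> c1; apply: (cvg_unique (@ereal_hausdorff R) c1 (E _ _ _ _ _ ih2 mY2 h20)).
Qed.

(** Signed weights destroy monotonicity, so the limit is taken by dominated convergence, first for
    nonnegative functions and then for the positive and negative parts of [f]. *)
Lemma integral_weighted (f : S -> R) : measurable_fun setT f ->
  mu1.-integrable setT (fun x => (h1 x * f (Y1 x))%:E) ->
  mu2.-integrable setT (fun x => (h2 x * f (Y2 x))%:E) ->
  (\int[mu1]_x (h1 x * f (Y1 x))%:E = \int[mu2]_x (h2 x * f (Y2 x))%:E)%E.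
Proof.
have ge0 (g : S -> R) : measurable_fun setT g -> (forall x, 0 <= g x) ->
    mu1.-integrable setT (fun x => (h1 x * g (Y1 x))%:E) ->
    mu2.-integrable setT (fun x => (h2 x * g (Y2 x))%:E) ->
  (\int[mu1]_x (h1 x * g (Y1 x))%:E = \int[mu2]_x (h2 x * g (Y2 x))%:E)%E.
  move=> mg g0 ig1 ig2.
  pose mF : measurable_fun setT (EFin \o g) := (measurable_EFinP _ _).2 mg.
  pose f_ n := nnsfun_approx measurableT mF n.
  have E d' (T : measurableType d') (mu : {measure set T -> \bar R}) (h : T -> R)
      (Y : T -> S) : mu.-integrable setT (EFin \o h) -> measurable_fun setT Y ->
      mu.-integrable setT (fun x => (h x * g (Y x))%:E) ->
    (\int[mu]_x (h x * f_ n (Y x))%:E @[n --> \oo] -->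
       \int[mu]_x (h x * g (Y x))%:E)%E.
    move=> ih mY ihg.
    have mhf n : measurable_fun setT (fun x => (h x * f_ n (Y x))%:E).
      apply/measurable_EFinP/measurable_funM.
        by case/integrableP: ih => /measurable_EFinP.
      exact: measurableT_comp.
    have mhg : measurable_fun setT (fun x => (h x * g (Y x))%:E).
      by case/integrableP: ihg.
    have [] // := @dominated_convergence _ _ _ mu _ measurableT _ _
      (fun x => `|h x * g (Y x)|%:E) mhf mhg.
    - apply: aeW => x _; under eq_fun do rewrite EFinM.
      rewrite EFinM; apply: cvgeZl => //.
      exact: (cvg_nnsfun_approx measurableT mF (fun x _ => g0 x)).
    - exact: (integrable_norm ihg).
    - apply: aeW => x n _ /=; rewrite lee_fin !normrM ler_wpM2l// !ger0_norm//.
      rewrite -lee_fin /f_ nnsfun_approxE.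
      by apply: (le_approx n (fun x _ => g0 x : (0 <= (EFin \o g) x)%E)).
  have := E _ _ _ _ _ ih1 mY1 ig1.
  under eq_fun do rewrite integral_weighted_nnsfun.
  by move=> c1; apply: (cvg_unique (@ereal_hausdorff R) c1 (E _ _ _ _ _ ih2 mY2 ig2)).
move=> mf i1 i2.
have mp := measurable_funrpos mf; have mn := measurable_funrneg mf.
have iP d' (T : measurableType d') (mu : {measure set T -> \bar R}) (h : T -> R)
    (Y : T -> S) (k : S -> R) : mu.-integrable setT (EFin \o h) ->
    measurable_fun setT Y ->
    measurable_fun setT k -> (forall x, `|k x| <= `|f x|) ->
    mu.-integrable setT (fun x => (h x * f (Y x))%:E) ->
    mu.-integrable setT (fun x => (h x * k (Y x))%:E).
  move=> ih mY mk kf; apply: le_integrable => //.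
    apply/measurable_EFinP/measurable_funM.
      by case/integrableP: ih => /measurable_EFinP.
    exact: measurableT_comp.
  by move=> x _ /=; rewrite lee_fin !normrM ler_wpM2l.
have bp x : `|f^\+%R x| <= `|f x|.
  by rewrite -/(funrpos f x) /funrpos ger0_norm ?le_max ?lexx ?orbT// ge_max ler_norm normr_ge0.
have bn x : `|f^\-%R x| <= `|f x|.
  by rewrite /funrneg ger0_norm ?le_max ?lexx ?orbT// ge_max -normrN ler_norm normr_ge0.
have E d' (T : measurableType d') (mu : {measure set T -> \bar R}) (h : T -> R)
    (Y : T -> S) : mu.-integrable setT (EFin \o h) -> measurable_fun setT Y ->
    mu.-integrable setT (fun x => (h x * f (Y x))%:E) ->
    (\int[mu]_x (h x * f (Y x))%:E =
     \int[mu]_x (h x * f^\+%R (Y x))%:E - \int[mu]_x (h x * f^\-%R (Y x))%:E)%E.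
  move=> ih mY ihf; rewrite -integralB//; [|exact: iP..].
  apply: eq_integral => x _ /=; rewrite -EFinB -mulrBr; congr (_ * _)%:E.
  by rewrite -[in LHS](funrposBneg f).
by rewrite !E// !ge0//; try exact: iP; move=> x; rewrite ?funrpos_ge0 ?funrneg_ge0.
Qed.

End WeightedImages.

(** * Bounds on all absolute moments *)

Section Moments.
Context (R : realType) d (T : measurableType d) (P : probability T R).
Implicit Types (f g : T -> R) (M N : nat -> R).

(** One sequence [M] can serve all the variables at once, which keeps the later constants
    independent of the matrix size. *)
Definition moments_le M f : Prop := measurable_fun setT f /\
  forall k, (\int[P]_x (`|f x| ^+ k)%:E <= (M k)%:E)%E.

Lemma moments_le_integrable M f : moments_le M f ->
  P.-integrable setT (EFin \o f).
Proof.
move=> [mf /(_ 1%N) M1]; apply/integrableP; split; first exact/measurable_EFinP.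
by apply: le_lt_trans (ltry (M 1%N)).
Qed.

Lemma moments_le_Rintegral M f : moments_le M f -> `|\int[P]_x f x| <= M 1%N.
Proof.
move=> Mf; have fi := moments_le_integrable Mf.
apply: le_trans (le_normr_Rintegral measurableT fi) _.
rewrite -lee_fin fineK; last by apply: integrable_fin_num => //; exact: integrable_norm.
by case: Mf => _ /(_ 1%N).
Qed.

Lemma moments_le_dom M f g : measurable_fun setT f ->
  (forall x, `|f x| <= `|g x|) -> moments_le M g -> moments_le M f.
Proof.
move=> mf fg [mg Mg]; split=> // k; apply: le_trans (Mg k).
apply: ge0_le_integral => //.
- by apply/measurable_EFinP/measurable_funX/measurableT_comp.
- by apply/measurable_EFinP/measurable_funX/measurableT_comp.
- by move=> x _; rewrite lee_fin; apply: lerXn2r; rewrite ?nnegrE.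
Qed.

Lemma moments_le_cst (c : R) : moments_le (fun k => `|c| ^+ k) (fun=> c).
Proof. by split=> // k; rewrite integral_cst//= probability_setT mule1. Qed.

Lemma moments_le1 : moments_le (fun=> 1) (fun=> 1).
Proof.
split=> // k; under eq_integral do rewrite normr1 expr1n.
by rewrite integral_cst//= probability_setT mule1.
Qed.

Lemma moments_le_indic (A : set T) : measurable A -> moments_le (fun=> 1) (\1_A).
Proof.
move=> mA; apply: moments_le_dom moments_le1 => // x.
by rewrite indicE; case: (_ \in _); rewrite ?normr0 normr1.
Qed.

(** From [a * b <= a ^+ 2 + b ^+ 2] with [a] and [b] the [k]-th powers of [|f|] and [|g|]; hence the
    doubled orders. *)
Lemma moments_leM M N f g : moments_le M f -> moments_le N g ->
  moments_le (fun k => M k.*2 + N k.*2) (fun x => f x * g x).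
Proof.
move=> [mf Mf] [mg Mg]; split; first exact: measurable_funM.
move=> k; apply: le_trans (leeD (Mf k.*2) (Mg k.*2)).
have mX (h : T -> R) : measurable_fun setT h ->
    measurable_fun setT (fun x => (`|h x| ^+ k.*2)%:E).
  by move=> mh; apply/measurable_EFinP/measurable_funX/measurableT_comp.
rewrite -ge0_integralD//; [|exact: mX..].
apply: ge0_le_integral => //.
- by apply/measurable_EFinP/measurable_funX/measurableT_comp/measurable_funM.
- by apply: emeasurable_funD; exact: mX.
move=> x _; rewrite -EFinD lee_fin normrM exprMn -!muln2 !exprM.
set a := _ ^+ k; set b := _ ^+ k.
have : 0 <= a by exact: exprn_ge0.
have : 0 <= b by exact: exprn_ge0.
nra.
Qed.

Fixpoint prod_bound M n : nat -> R :=
  if n is n'.+1 then fun k => M k.*2 + prod_bound M n' k.*2 else fun=> 1.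

Lemma moments_le_prod (I : Type) M (s : seq I) (F : I -> T -> R) :
  (forall i, moments_le M (F i)) ->
  moments_le (prod_bound M (size s)) (fun x => \prod_(i <- s) F i x).
Proof.
move=> MF; elim: s => [|i s IH] /=.
  by under [X in moments_le _ X]eq_fun do rewrite big_nil; exact: moments_le1.
by under [X in moments_le _ X]eq_fun do rewrite big_cons; exact: moments_leM.
Qed.

Lemma moments_leX M f p : moments_le M f ->
  moments_le (fun k => M (p * k)%N) (fun x => f x ^+ p).
Proof.
move=> [mf Mf]; split; first exact: measurable_funX.
by move=> k; under eq_integral do rewrite normrX -exprM.
Qed.

End Moments.

(** * From indicators to arbitrary functions of independent variables *)

Section IndependentProducts.
Context (R : realType) d (T : measurableType d) (P : probability T R).
Context (I : eqType) (Y : I -> T -> R).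
Hypothesis mY : forall i, measurable_fun setT (Y i).
Hypothesis indepY : forall (s : seq I) (B : I -> set R), uniq s ->
  (forall i, measurable (B i)) ->
  \int[P]_x (\prod_(i <- s) \1_(B i) (Y i x)) =
  \prod_(i <- s) \int[P]_x (\1_(B i) (Y i x)).

Let ml_ind (B : set R) i : measurable B ->
  moments_le P (fun=> 1) (fun x => \1_B (Y i x)).
Proof.
move=> mB; rewrite (_ : (fun x => _) = \1_(Y i @^-1` B)).
  by apply: moments_le_indic; rewrite -[X in measurable X]setTI; exact: mY.
by apply/funext => x; rewrite !indicE; congr (_%:R); apply/idP/idP; rewrite !inE.
Qed.

(* The indicators of [u] are the variables not yet treated: the induction on
   [s] replaces them one at a time by arbitrary functions [f i]. *)
Lemma Rintegral_prod_indic (s u : seq I) (f : I -> R -> R) (B : I -> set R)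
    (M : I -> nat -> R) :
  uniq (s ++ u) -> (forall i, measurable (B i)) ->
  (forall i, measurable_fun setT (f i)) ->
  (forall i, moments_le P (M i) (fun x => f i (Y i x))) ->
  \int[P]_x (\prod_(i <- s) f i (Y i x) * \prod_(i <- u) \1_(B i) (Y i x)) =
  (\prod_(i <- s) \int[P]_x f i (Y i x)) *
  \prod_(i <- u) \int[P]_x \1_(B i) (Y i x).
Proof.
move=> + + mf Mf.
have mls s' : exists N, moments_le P N (fun x => \prod_(i <- s') f i (Y i x)).
  elim: s' => [|i s' [N MN]].
    by exists (fun=> 1); under [X in moments_le _ _ X]eq_fun do rewrite big_nil; exact: moments_le1.
  exists (fun k => M i k.*2 + N k.*2).
  by under [X in moments_le _ _ X]eq_fun do rewrite big_cons; exact: moments_leM.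
elim: s u B => [|a s IH] u B usu mB.
  by under eq_Rintegral do rewrite big_nil mul1r; rewrite big_nil mul1r indepY.
have [N MN] := mls s.
have ml_u : moments_le P (prod_bound (fun=> 1) (size u)) (fun x => \prod_(i <- u) \1_(B i) (Y i x)).
  by apply: moments_le_prod => i; exact: ml_ind.
pose g x := \prod_(i <- s) f i (Y i x) * \prod_(i <- u) \1_(B i) (Y i x).
have [G Mg] : exists G, moments_le P G g by eexists; exact: moments_leM MN ml_u.
have [sa ua] : uniq (s ++ u) /\ uniq (s ++ a :: u).
  move: usu; rewrite cat_cons cons_uniq => /andP[asu usu]; split=> //.
  by rewrite uniq_catC cat_cons cons_uniq uniq_catC usu mem_cat orbC -mem_cat asu.
have aNu : a \notin u.
  by move: usu; rewrite cat_cons cons_uniq mem_cat negb_or => /andP[/andP[]].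
pose c := \int[P]_x g x.
have iab (h : T -> R) K : moments_le P K h -> P.-integrable setT (EFin \o h).
  exact: moments_le_integrable.
(* The independence of [Y a] from the other factors, read as an equality of weighted images: signed
   weight [g] against constant weight [c]. On indicators it is the induction hypothesis with [a]
   moved into [u]; [integral_weighted] then passes to [f a]. *)
have H B0 : measurable B0 ->
  (\int[P]_x (g x * \1_B0 (Y a x))%:E = \int[P]_x (c * \1_B0 (Y a x))%:E)%E.
  move=> mB0.
  pose B' i := if i == a then B0 else B i.
  have mB' i : measurable (B' i) by rewrite /B'; case: eqP.
  have uB i x : i \in u -> \1_(B' i) (Y i x) = \1_(B i) (Y i x) :> R.
    by rewrite /B'; case: eqP => // ->; rewrite (negbTE aNu).
  have := IH (a :: u) B' ua mB'; have := IH u B sa mB; rewrite -/c => cE E.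
  rewrite -[LHS]fineK; last first.
    apply: integrable_fin_num => //; apply: (iab (fun x => g x * \1_B0 (Y a x))).
    by apply: moments_leM Mg _; exact: ml_ind.
  rewrite -[RHS]fineK; last first.
    apply: integrable_fin_num => //; apply: (iab (fun x => c * \1_B0 (Y a x))).
    apply: moments_leM (moments_le_cst P c) _; exact: ml_ind.
  congr _%:E; rewrite -[LHS]/(\int[P]_x _) -[RHS]/(\int[P]_x _).
  rewrite RintegralZl//; last by apply: iab; exact: ml_ind.
  transitivity (\int[P]_x (\prod_(i <- s) f i (Y i x) * \prod_(i <- a :: u) \1_(B' i) (Y i x))).
    apply: eq_Rintegral => x _; rewrite /g big_cons {1}/B' eqxx mulrAC mulrA.
    by congr (_ * _); apply: eq_big_seq => i /uB ->.
  rewrite E cE big_cons {1}/B' eqxx mulrAC mulrA; congr (_ * _ * _).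
  by apply: eq_big_seq => i iu; apply: eq_Rintegral => x _; rewrite uB.
transitivity (\int[P]_x (g x * f a (Y a x))).
  by apply: eq_Rintegral => x _; rewrite big_cons -mulrA mulrC.
transitivity (\int[P]_x (c * f a (Y a x))).
  congr fine; apply: (integral_weighted _ _ _ _ H) => //.
  - exact: iab Mg.
  - exact: iab (moments_le_cst P c).
  - exact: iab (moments_leM Mg (Mf a)).
  - exact: iab (moments_leM (moments_le_cst P c) (Mf a)).
rewrite RintegralZl//; last exact: iab (Mf a).
by rewrite /c (IH u B sa mB) big_cons mulrC mulrA.
Qed.

End IndependentProducts.

(** * Independence between and within families; mixed moments *)

Section TwoLevelIndependence.
Context (R : realType) d (T : measurableType d) (P : probability T R).
Context (m : nat) (J : choiceType) (X : 'I_m -> J -> T -> R).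
Hypothesis mX : forall i j, measurable_fun setT (X i j).
Hypothesis X_fam : indep_families P X.
Hypothesis X_RV : forall i, indep_RVs P (X i).

Let Y (a : 'I_m * J) := X a.1 a.2.

Lemma sigma_RVs_bigcap (i : 'I_m) (s : seq J) (B : J -> set R) :
  (forall j, measurable (B j)) ->
  sigma_RVs (X i) (\bigcap_(j in [set` s]) X i j @^-1` B j).
Proof.
move=> mB; rewrite bigcap_seq.
pose G' : set (set T) := [set A | exists j C, measurable C /\ A = X i j @^-1` C].
apply: (@bigsetI_measurable _ (g_sigma_algebraType G') J s xpredT
  (fun j => X i j @^-1` B j)) => j _; apply: sub_sigma_algebra.
by exists j, (B j).
Qed.

(** The event is grouped by family: independence of the families splits the product over [i], and
    independence inside family [i] splits each factor. *)
Lemma prob_bigcap_two_level (s : seq ('I_m * J)) (B : 'I_m * J -> set R) :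
  uniq s -> (forall a, measurable (B a)) ->
  (P (\bigcap_(a in [set` s]) Y a @^-1` B a) = \prod_(a <- s) P (Y a @^-1` B a))%E.
Proof.
move=> us mB.
pose si i := [seq a.2 | a <- s & a.1 == i].
pose A i := \bigcap_(j in [set` si i]) X i j @^-1` B (i, j).
(* All families are listed; one without a letter in [s] contributes the whole space, as an empty
   intersection. *)
have -> : \bigcap_(a in [set` s]) Y a @^-1` B a =
    \bigcap_(i in [set` (seq_fset tt (enum 'I_m))]) A i.
  apply/seteqP; split=> x /= xs.
    move=> i _ j /= /mapP[[i' j'] /=]; rewrite mem_filter => /andP[/= /eqP -> ijs ->].
    exact: (xs (i, j')).
  move=> [i j] /= ijs; have im : i \in seq_fset tt (enum 'I_m) by rewrite seq_fsetE mem_enum.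
  by apply: (xs i im j); apply/mapP; exists (i, j) => //; rewrite mem_filter /= eqxx.
rewrite X_fam; last by move=> i _; apply: sigma_RVs_bigcap.
rewrite (perm_big _ (seq_fset_perm tt _)) undup_id ?enum_uniq// big_enum /=.
have AE i : (P (A i) = \prod_(a <- s | a.1 == i) P (Y a @^-1` B a))%E.
  have us_i : uniq (si i).
    rewrite map_inj_in_uniq ?filter_uniq// => -[i1 j1] [i2 j2].
    by rewrite !mem_filter /= => /andP[/eqP -> _] /andP[/eqP -> _] ->.
  have -> : A i = \bigcap_(j in [set` (seq_fset tt (si i))]) X i j @^-1` B (i, j).
    rewrite /A; congr (\bigcap_(j in _) _); apply/seteqP.
    by split=> j; rewrite /mkset seq_fsetE.
  rewrite (@X_RV i); last first.
    by move=> j _; apply: sub_sigma_algebra; exists tt, (B (i, j)).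
  rewrite (perm_big _ (seq_fset_perm tt _)) undup_id// big_map big_filter.
  by apply: eq_bigr => -[i' j'] /= /eqP ->.
under eq_bigr do rewrite AE.
rewrite (exchange_big_dep xpredT)//=; apply: eq_bigr => a _.
by rewrite (big_pred1 a.1).
Qed.

Lemma Rintegral_prod_indic_two_level (s : seq ('I_m * J)) (B : 'I_m * J -> set R) :
  uniq s -> (forall a, measurable (B a)) ->
  \int[P]_x (\prod_(a <- s) \1_(B a) (Y a x)) =
  \prod_(a <- s) \int[P]_x (\1_(B a) (Y a x)).
Proof.
move=> us mB.
have mYB a : measurable (Y a @^-1` B a).
  by rewrite -[X in measurable X]setTI; exact: mX.
have indic_preim a x : \1_(B a) (Y a x) = \1_(Y a @^-1` B a) x :> R.
  by rewrite !indicE; congr (_%:R); apply/idP/idP; rewrite !inE.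
have RP (A : set T) : measurable A -> \int[P]_x (\1_A x) = fine (P A).
  by move=> mA; rewrite /Rintegral integral_indic// setIT.
transitivity (\int[P]_x (\1_(\bigcap_(a in [set` s]) Y a @^-1` B a) x)).
  apply: eq_Rintegral => x _; rewrite indicE.
  have [xs|xs] := boolP (x \in _).
    rewrite big_seq big1// => a aS; rewrite indic_preim indicE mem_set//.
    by move: xs; rewrite inE => /(_ a aS).
  move: xs; rewrite notin_setE => xs.
  have [a aS ax] : exists2 a, a \in s & ~ B a (Y a x).
    apply: contrapT => nex; apply: xs => a /= aS.
    by apply: contrapT => nB; apply: nex; exists a.
  by rewrite (big_rem a)//= indicE memNset// mul0r.
rewrite RP; last by rewrite bigcap_seq; apply: bigsetI_measurable.
rewrite prob_bigcap_two_level//.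
apply: EFin_inj; rewrite fineK; last by apply: prode_fin_num => a _; exact: fin_num_measure.
rewrite -prodEFin; apply: eq_bigr => a _.
under eq_Rintegral do rewrite indic_preim.
by rewrite RP// fineK// fin_num_measure.
Qed.

Variable M : nat -> R.
Hypothesis MX : forall i j, moments_le P M (X i j).

Definition mixed_moment (q : seq ('I_m * J)) : R := \int[P]_x \prod_(a <- q) Y a x.

Lemma mixed_moment_nil : mixed_moment [::] = 1.
Proof.
rewrite /mixed_moment; under eq_Rintegral do rewrite big_nil.
by rewrite Rintegral_cst//= probability_setT /= mulr1.
Qed.

Lemma mixed_moment_le q : `|mixed_moment q| <= prod_bound M (size q) 1.
Proof. by apply: moments_le_Rintegral; apply: moments_le_prod => a; exact: MX. Qed.

Lemma prod_uniq_count (A : comPzSemiRingType) (K : eqType) (F : K -> A) (q s : seq K) :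
  uniq s -> {subset q <= s} ->
  \prod_(a <- q) F a = \prod_(b <- s) F b ^+ count_mem b q.
Proof.
move=> us; elim: q => [|a q IH] qs.
  by rewrite big_nil big1// => b _; rewrite expr0.
have as_ : a \in s by rewrite qs ?mem_head.
rewrite big_cons IH; last by move=> b bq; rewrite qs// inE bq orbT.
under [RHS]eq_bigr do rewrite /= exprD.
rewrite big_split/= (bigD1_seq a)//= [X in _ = X * _](bigD1_seq a)//= eqxx expr1.
rewrite [X in _ = _ * X * _]big1 ?mulr1// => b /negbTE.
by rewrite eq_sym => ->; rewrite expr0.
Qed.

Lemma mixed_moment_prod (q s : seq ('I_m * J)) : uniq s -> {subset q <= s} ->
  mixed_moment q = \prod_(b <- s) \int[P]_x (Y b x ^+ count_mem b q).
Proof.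
move=> us qs.
have := @Rintegral_prod_indic _ _ _ P _ Y (fun a => mX a.1 a.2)
  Rintegral_prod_indic_two_level s [::] (fun b y => y ^+ count_mem b q)
  (fun=> setT) (fun b k => M (count_mem b q * k)%N).
rewrite cats0 big_nil mulr1 => <-//.
- by apply: eq_Rintegral => x _; rewrite big_nil mulr1; exact: prod_uniq_count.
- by move=> a; apply: moments_leX; exact: MX.
Qed.

(** The form in which independence enters the Wick recursion, as [G_split]. The letter [a] need not
    occur in [q]: [mixed_moment_prod] allows letters of exponent 0. *)
Lemma mixed_moment_split a q : mixed_moment q =
  (\int[P]_x Y a x ^+ count_mem a q) * mixed_moment (seq.filter (predC1 a) q).
Proof.
pose s := seq.filter (predC1 a) (undup q).
have us : uniq s by rewrite filter_uniq// undup_uniq.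
rewrite (@mixed_moment_prod q (a :: s)); last 2 first.
- by rewrite cons_uniq us andbT mem_filter /= eqxx.
- by move=> b bq; rewrite inE mem_filter /= mem_undup bq andbT orbN.
rewrite (@mixed_moment_prod (seq.filter _ q) s)//; last first.
  by move=> b; rewrite !mem_filter mem_undup.
rewrite big_cons; congr (_ * _); apply: eq_big_seq => b.
rewrite mem_filter => /andP[/= ba _]; congr Rintegral; apply/funext => x.
congr (_ ^+ _); rewrite count_filter; apply: eq_count => c /=.
by case: eqVneq => // ->; rewrite ba.
Qed.

End TwoLevelIndependence.

(** * Gaussian moments *)

Section GaussianMoments.
Context (R : realType).
Notation mu := (@lebesgue_measure R).
Local Notation g := (@gauss_fun R).

Definition gauss_dom (k : nat) : R := 1 + 2 ^+ k * k`!%:R.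

Lemma gauss_dom_ge0 k : 0 <= gauss_dom k.
Proof. by rewrite addr_ge0// mulr_ge0. Qed.

(** One term of the exponential series gives [(x ^+ 2 / 2) ^+ k <= k! * exp (x ^+ 2 / 2)], and
    [|x| ^+ k <= 1 + x ^+ (2 * k)]. This uses up half of the exponent of [g x = exp (- x ^+ 2)]. *)
Lemma norm_exp_gauss_le k (x : R) :
  `|x ^+ k * g x| <= gauss_dom k * expR (- x ^+ 2 / 2).
Proof.
have y0 : 0 <= x ^+ 2 / 2 by rewrite divr_ge0// sqr_ge0.
have H1 : (x ^+ 2 / 2) ^+ k <= k`!%:R * expR (x ^+ 2 / 2).
  case: k => [|k]; first by rewrite expr0 fact0 mul1r; apply: le_trans (expR_ge1Dx _); rewrite lerDl.
  rewrite -ler_pdivrMl ?ltr0n ?fact_gt0// [X in X <= _]mulrC.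
  by apply: le_trans (expR_ge1Dxn k y0); rewrite lerDr.
have H2 : `|x| ^+ k <= gauss_dom k * expR (x ^+ 2 / 2).
  have H3 : `|x| ^+ k <= 1 + (x ^+ 2) ^+ k.
    have -> : (x ^+ 2) ^+ k = (`|x| ^+ k) ^+ 2.
      by rewrite -[RHS]exprM mulnC exprM real_normK ?num_real.
    have : 0 <= `|x| ^+ k by exact: exprn_ge0.
    by move: (`|x| ^+ k) => a a0; nra.
  apply: le_trans H3 _.
  rewrite /gauss_dom mulrDl mul1r lerD//; first by apply: le_trans (expR_ge1Dx _); rewrite lerDl.
  rewrite -mulrA -ler_pdivrMl ?exprn_gt0//; apply: le_trans H1.
  by rewrite expr_div_n mulrC.
rewrite normrM normrX (ger0_norm (gauss_fun_ge0 x)) /gauss_fun.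
rewrite [X in _ * expR X <= _](_ : _ = - x ^+ 2 / 2 + - x ^+ 2 / 2); last by field.
rewrite expRD mulrA; apply: ler_wpM2r; first exact: expR_ge0.
by rewrite mulNr expRN -ler_pdivlMr ?invrK// invr_gt0 expR_gt0.
Qed.

Lemma integrable_exp_gauss k : mu.-integrable setT (EFin \o (fun x => x ^+ k * g x)).
Proof.
have ig : mu.-integrable setT
    (fun x => (gauss_dom k / normal_peak 1)%:E * (normal_pdf 0 1 x)%:E)%E.
  by apply: integrableZl => //; exact: integrable_normal_pdf.
apply: (le_integrable measurableT _ _ ig) => /=.
  apply/measurable_EFinP/measurable_funM; last exact: measurable_gauss_fun.
  exact: measurable_funX.
move=> x _; rewrite lee_fin; apply: le_trans (norm_exp_gauss_le k x) _.
rewrite normal_pdfE ?oner_eq0// /normal_fun subr0 expr1n mulrA divfK ?ler_norm//.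
by rewrite gt_eqF// normal_peak_gt0 ?oner_eq0.
Qed.

Lemma cvg_integral_growing_itv (f : R -> R) : mu.-integrable setT (EFin \o f) ->
  (\int[mu]_(x in `[(- n%:R)%R, n%:R%R]) (f x)%:E @[n --> \oo] -->
   \int[mu]_x (f x)%:E)%E.
Proof.
move=> fi; have mf : measurable_fun setT (EFin \o f) by case/integrableP: fi.
under eq_fun do rewrite integral_mkcond.
have [] // := @dominated_convergence _ _ _ mu _ measurableT
  (fun n => (EFin \o f) \_ `[- n%:R, n%:R]) (EFin \o f) (fun x => `|f x|%:E).
- by move=> n; apply/(measurable_restrictT _ _).1 => //; exact: measurable_funTS.
- apply: aeW => x _; apply: cvg_near_cst; near=> n.
  rewrite patchE mem_set//= in_itv/= -ler_norml.
  by near: n; exact: nbhs_infty_ger.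
- exact: integrable_norm.
- by apply: aeW => x n _; rewrite patchE; case: ifP => _ //=; rewrite ?normr0 lee_fin.
Unshelve. all: by end_near. Qed.

(** Integration by parts: the derivative of [x ^+ p * g x] has integral 0 over the line. For [p = 0]
    the truncated predecessor is harmless, being multiplied by 0. *)
Lemma Rintegral_exp_gauss_rec p :
  \int[mu]_x (x ^+ p.+1 * g x) = p%:R / 2 * \int[mu]_x (x ^+ p.-1 * g x).
Proof.
pose G (x : R) := x ^+ p * g x.
pose G' (x : R) := p%:R * (x ^+ p.-1 * g x) - 2 * (x ^+ p.+1 * g x).
have dG (x : R) : is_derive x 1 G (G' x).
  rewrite /G /G' /gauss_fun.
  have d1 k : is_derive x 1 (fun y : R => y ^+ k) (k%:R * x ^+ k.-1).
    by apply: DeriveDef; [exact: exprn_derivable|rewrite exp_derive /GRing.scale/= mulr1].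
  have d2 : is_derive x 1 (fun y : R => - y ^+ 2) (- (2%:R * x ^+ 1)) by apply: is_deriveN.
  have d3 := @is_derive1_comp R expR (fun y => - y ^+ 2) x _ _ (is_derive_expR _) d2.
  rewrite (_ : _ - _ = x ^+ p * (expR (- x ^+ 2) * - (2%:R * x ^+ 1)) +
    expR (- x ^+ 2) * (p%:R * x ^+ p.-1)); last by rewrite [x ^+ p.+1]exprS; ring.
  exact: is_deriveM (d1 p) d3.
have iG' : mu.-integrable setT (EFin \o G').
  rewrite /G'; under [X in mu.-integrable _ X]eq_fun do rewrite /= EFinB !EFinM.
  by apply: integrableB => //; apply: integrableZl => //; exact: integrable_exp_gauss.
have cXg k : continuous (fun x : R => x ^+ k * g x).
  by move=> x; apply: cvgM; [exact: exprn_continuous|exact: continuous_gauss_fun].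
have cG' : continuous G'.
  by move=> x; apply: cvgB; (apply: cvgM; [exact: cvg_cst|exact: cXg]).
(* The successor keeps the interval nondegenerate. *)
have FTC n : (\int[mu]_(x in `[(- n.+1%:R)%R, n.+1%:R%R]) (G' x)%:E = (G n.+1%:R - G (- n.+1%:R))%:E)%E.
  rewrite EFinB; apply: continuous_FTC2.
  - by rewrite gtrN ?ltr0n.
  - exact: continuous_subspaceT.
  - split=> [x _|//|//]; first exact: ex_derive.
      by apply: cvg_at_right_filter; exact: cXg.
    by apply: cvg_at_left_filter; exact: cXg.
  - by move=> x _; rewrite derive1E; exact: derive_val.
have G0 : (G n.+1%:R - G (- n.+1%:R)) @[n --> \oo] --> (0 : R).
  (* Since [x * G x] is again a power times [g], it is bounded, so [G] decays at least like the
     inverse of [|x|]. The sign [s] below treats both endpoints together. *)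
  have Gle (x : R) : x != 0 -> `|G x| <= gauss_dom p.+1 * `|x|^-1.
    move=> x0; rewrite ler_pdivlMr ?normr_gt0// mulrC -normrM mulrA -exprS.
    apply: le_trans (norm_exp_gauss_le _ _) _.
    rewrite ler_piMr ?gauss_dom_ge0// -[X in _ <= X]expR0 ler_expR mulNr.
    by rewrite oppr_le0 divr_ge0 ?sqr_ge0.
  have inv0 : n.+1%:R^-1 @[n --> \oo] --> (0 : R) by exact: cvg_harmonic.
  have GN (s : bool) : G ((-1) ^+ s * n.+1%:R) @[n --> \oo] --> (0 : R).
    apply/norm_cvg0P; apply: (@squeeze_cvgr _ _ _ _ (fun=> 0)
      (fun n => gauss_dom p.+1 * n.+1%:R^-1)).
    - apply: nearW => n; rewrite normr_ge0 /=.
      apply: le_trans (Gle _ _) _; first by rewrite mulf_neq0 ?signr_eq0 ?pnatr_eq0.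
      by rewrite normrM normr_sign mul1r ger0_norm.
    - exact: cvg_cst.
    - by rewrite -[X in _ --> X](mulr0 (gauss_dom p.+1)); apply: cvgMl_tmp.
  rewrite (_ : (fun n => _) = (fun n => G ((-1) ^+ false * n.+1%:R)) -
    (fun n => G ((-1) ^+ true * n.+1%:R))).
    by rewrite -[X in _ --> X](subr0 0); exact: cvgB.
  by apply/funext => n; rewrite !fctE /= expr0 mul1r expr1 mulN1r.
have : (\int[mu]_x (G' x)%:E = 0)%E.
  have := cvg_integral_growing_itv iG'; rewrite -(cvg_shiftS _).
  under eq_fun do rewrite FTC.
  move=> c1; apply: (cvg_unique (@ereal_hausdorff R) c1).
  by apply: cvg_EFin; [exact: nearW|exact: G0].
move=> /(congr1 fine); rewrite -[LHS]/(\int[mu]_x G' x) /=.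
have iZ c k : mu.-integrable setT (EFin \o (fun x => c * (x ^+ k * g x))).
  under [X in mu.-integrable _ X]eq_fun do rewrite /= EFinM.
  by apply: integrableZl => //; exact: integrable_exp_gauss.
rewrite RintegralB// !RintegralZl//; try exact: integrable_exp_gauss.
lra.
Qed.


(** The variance is 1/2, that of the real and imaginary parts of a complex standard Gaussian
    variable; the density is then a multiple of [exp (- x ^+ 2)]. *)
Definition gauss_abs_moment (k : nat) : R :=
  fine (\int[mu]_x `|(normal_pdf 0 (Num.sqrt 2^-1) x * x ^+ k)%:E|)%E.

Context d (T : measurableType d) (P : probability T R) (U : {RV P >-> R}).
Hypothesis U_law : forall B, measurable B ->
  P (U @^-1` B) = normal_prob 0 (Num.sqrt 2^-1) B.

Let s : R := Num.sqrt 2^-1.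

Let s0 : s != 0.
Proof. by rewrite /s gt_eqF// sqrtr_gt0 invr_gt0. Qed.

Let pdfE x : normal_pdf 0 s x = normal_peak s * g x.
Proof.
rewrite normal_pdfE// /normal_fun subr0 /gauss_fun; congr (_ * expR _).
by rewrite /s sqr_sqrtr ?invr_ge0// -mulr_natr mulVf ?divr1// pnatr_eq0.
Qed.

Let integrable_exp_pdf k :
  mu.-integrable setT (fun x => (normal_pdf 0 s x * x ^+ k)%:E).
Proof.
under [X in mu.-integrable _ X]eq_fun => x do
  rewrite pdfE -mulrA [g x * _]mulrC EFinM.
by apply: integrableZl => //; exact: integrable_exp_gauss.
Qed.

Let law B : measurable B ->
  (\int[P]_x (1 * \1_B (U x))%:E = \int[mu]_x (normal_pdf 0 s x * \1_B x)%:E)%E.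
Proof.
move=> mB; transitivity (P (U @^-1` B)).
  under eq_integral do rewrite mul1r.
  have mUB : measurable (U @^-1` B).
    by rewrite -[X in measurable X]setTI; exact: measurable_funP.
  transitivity (\int[P]_x (\1_(U @^-1` B) x)%:E)%E; last by rewrite integral_indic// setIT.
  by apply: eq_integral => x _; rewrite !indicE; congr (_%:R%:E); apply/idP/idP; rewrite !inE.
rewrite U_law// /normal_prob integral_mkcond; apply: eq_integral => x _.
by rewrite patchE indicE; case: ifP => _; rewrite ?mulr1 ?mulr0.
Qed.

Let iP1 : P.-integrable setT (EFin \o (fun=> 1 : R)).
Proof. exact: moments_le_integrable (moments_le1 P). Qed.

Let ipdf : mu.-integrable setT (EFin \o normal_pdf 0 s).
Proof. exact: integrable_normal_pdf. Qed.

(** The law is compared with its density in the nonnegative form, because the integrability of the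
    powers of [U] is not yet known. *)
Lemma gauss_moments_le : moments_le P gauss_abs_moment U.
Proof.
split=> [|k]; first exact: measurable_funP.
have := integrable_exp_pdf k => /integrableP[_ fin].
rewrite /gauss_abs_moment fineK; last by rewrite ge0_fin_numE//; apply: integral_ge0.
have mX : measurable_fun setT (fun x : R => `|x| ^+ k).
  by apply: measurable_funX; exact: normr_measurable.
have := @ge0_integral_weighted _ _ _ _ _ _ _ _ _ _ _ _ _ iP1 ipdf
  (measurable_funP U) (@measurable_id _ _ setT) law (fun x => `|x| ^+ k) mX.
under eq_integral do rewrite mul1r.
move=> -> //; last by move=> x; exact: normal_pdf_ge0.
by under [leRHS]eq_integral do rewrite /= normrM normrX (ger0_norm (normal_pdf_ge0 _ _ _)).
Qed.

(** Gaussian integration by parts for variance 1/2, transported from the Lebesgue integral; it makes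
    the Wick defect of Gaussian words vanish. *)
Lemma gauss_moment_rec p :
  \int[P]_x (U x ^+ p.+1) = p%:R / 2 * \int[P]_x (U x ^+ p.-1).
Proof.
have MU := gauss_moments_le.
have E k : \int[P]_x (U x ^+ k) = normal_peak s * \int[mu]_x (x ^+ k * g x).
  transitivity (\int[mu]_x (normal_pdf 0 s x * x ^+ k)).
    under eq_Rintegral do rewrite -[_ ^+ k]mul1r.
    have := @integral_weighted _ _ _ _ _ _ _ _ _ _ _ _ _ iP1 ipdf
      (measurable_funP U) (@measurable_id _ _ setT) law (fun x => x ^+ k).
    move=> H; congr fine; apply: H.
    - exact: measurable_funX.
    - under [X in P.-integrable _ X]eq_fun do rewrite mul1r.
      exact: moments_le_integrable (moments_leX k MU).
    - exact: integrable_exp_pdf.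
  rewrite -RintegralZl//; last exact: integrable_exp_gauss.
  by apply: eq_Rintegral => x _; rewrite pdfE -mulrA [g x * _]mulrC.
by rewrite !E Rintegral_exp_gauss_rec mulrCA.
Qed.

End GaussianMoments.

(** * The Wick recursion on words *)

Section Words.
Context (A : eqType).
Implicit Types (e q s : seq A) (a : A).

(** The possible partners for contracting a letter placed in front of [s], each with the word that
    remains; repeated letters are listed once per occurrence. *)
Fixpoint splits (B : Type) (s : seq B) : seq (B * seq B) :=
  if s is x :: s' then (x, s') :: [seq (y.1, x :: y.2) | y <- splits s'] else [::].

Lemma size_splits s : size (splits s) = size s.
Proof. by elim: s => //= x s <-; rewrite size_map. Qed.

Lemma splits_fst s : [seq y.1 | y <- splits s] = s.
Proof. by elim: s => //= x s IH; rewrite -map_comp -[in RHS]IH. Qed.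

Lemma splits_perm s y : y \in splits s -> perm_eq (y.1 :: y.2) s.
Proof.
elim: s y => //= x s IH y; rewrite inE => /predU1P[->//|/mapP[u us ->]] /=.
by rewrite (perm_catCA [:: u.1] [:: x]) /= perm_cons IH.
Qed.

Lemma splits_size s y : y \in splits s -> size s = (size y.2).+1.
Proof. by move=> /splits_perm/perm_size <-. Qed.

Fixpoint words e n : seq (seq A) :=
  if n is n'.+1 then [seq a :: q | a <- e, q <- words e n'] else [:: [::]].

Lemma size_words e n : size (words e n) = (size e ^ n)%N.
Proof. by elim: n => //= n IH; rewrite size_allpairs IH expnS. Qed.

Lemma mem_words e n q : (q \in words e n) = (size q == n) && all (mem e) q.
Proof.
elim: n q => [|n IH] [|a q] //=; first by apply/negbTE/negP => /allpairsP[[b u] []].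
apply/allpairsP/idP => [[[b u]] /= [be uw [-> ->]]|].
  by move: uw; rewrite IH => /andP[/eqP -> ->]; rewrite eqxx be.
by move=> /and3P[qn ae qe]; exists (a, q); rewrite /= IH qe andbT -eqSS.
Qed.

Lemma words_uniq e n : uniq e -> uniq (words e n).
Proof.
move=> ue; elim: n => //= n IH; apply: allpairs_uniq => //.
by move=> [a q] [b u] _ _ /= [-> ->].
Qed.

End Words.

Lemma size_undup_count (A : eqType) (q : seq A) :
  size q = (\sum_(a <- undup q) count_mem a q)%N.
Proof.
rewrite -sum1_size -big_undup_iterop_count; apply: eq_bigr => a _.
by rewrite Monoid.iteropE iter_addn_0 mul1n.
Qed.

(** A word with at most [r] distinct letters is determined by a list of [r] letters and, for each of
    its [h] positions, an index into that list. *)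
Lemma count_few_letters (A : eqType) (a0 : A) (e : seq A) (r h : nat) :
  uniq e -> a0 \in e ->
  (count (fun q => size (undup q) <= r) (words e h) <= size e ^ r * r ^ h)%N.
Proof.
move=> ue a0e; rewrite -size_filter.
pose W := [seq [seq nth a0 g j | j <- f] | g <- words e r, f <- words (iota 0 r) h].
have <- : size W = (size e ^ r * r ^ h)%N by rewrite size_allpairs !size_words size_iota.
apply: uniq_leq_size; first by rewrite filter_uniq ?words_uniq.
move=> q; rewrite mem_filter mem_words => /andP[qr /andP[/eqP qh /allP qe]].
(* The list of distinct letters is padded with [a0] to length exactly [r]. *)
apply/allpairsP; exists (undup q ++ nseq (r - size (undup q)) a0, [seq index a (undup q) | a <- q]).
split=> /=.
- rewrite mem_words size_cat size_nseq subnKC// eqxx all_cat /=; apply/andP; split.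
    by apply/allP => a; rewrite mem_undup => /qe.
  by apply/allP => a /nseqP[-> _].
- rewrite mem_words size_map qh eqxx /=; apply/allP => j /mapP[a aq ->].
  by rewrite /= mem_iota add0n /= (leq_trans _ qr)// index_mem mem_undup.
rewrite -map_comp -[LHS]map_id; apply/eq_in_map => a aq /=.
by rewrite nth_cat index_mem mem_undup aq nth_index// mem_undup.
Qed.

(* The index words on which the Wick formula can fail. *)
Definition heavy (A : eqType) (q : seq A) : bool :=
  if q is a :: _ then all (fun b => 1 < count_mem b q)%N q && (2 < count_mem a q)%N
  else false.

(** Each distinct letter accounts for two positions and one of them for three. The position gained
    over plain pairings is what yields the factor 1/sqrt n. *)
Lemma heavy_undup (A : eqType) (q : seq A) :
  heavy q -> (size (undup q) <= (size q).-1./2)%N.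
Proof.
suff H (a : A) (s : seq A) : a \in s -> (forall b, b \in s -> (1 < count_mem b s)%N) ->
    (2 < count_mem a s)%N -> (size (undup s) <= (size s).-1./2)%N.
  by case: q => [//|a q] /andP[/allP q2 q3]; apply: (H a) => //; exact: mem_head.
move: s => {}q; rewrite -mem_undup => aq q2 q3.
have : ((size (undup q)).*2 < size q)%N.
  have : (\sum_(b <- undup q) (2 + (b == a)) <= size q)%N.
    rewrite [X in (_ <= X)%N]size_undup_count big_seq [X in (_ <= X)%N]big_seq.
    apply: leq_sum => b; rewrite mem_undup => bq.
    by case: eqVneq => [->|_]; [exact: q3|exact: q2].
  rewrite big_split /= big_const_seq count_predT iter_addn_0 -big_mkcond sum1_count.
  by rewrite count_uniq_mem ?undup_uniq// aq addn1 mul2n.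
by case: (size q) => // n; rewrite ltnS => /half_leq; rewrite doubleK.
Qed.

(** * Weighted sums over index words *)

Section WickSums.
Context (A : numFieldType) (L : finType) (K : finType).
Variable z : bool -> K -> A.
Implicit Types (F : seq (L * K) -> A) (s : seq (L * bool)).

(* The expansion of a product, over the letters [(i, b)] of [s], of the sums
   [\sum_k z b k * Y (i, k)], with [F q] in place of the product of the [Y a]
   for [a] in [q]. *)
Fixpoint wsum F s : A :=
  if s is x :: s' then \sum_k z x.2 k * wsum (fun q => F ((x.1, k) :: q)) s'
  else F [::].

Lemma eq_wsum F F' s : F =1 F' -> wsum F s = wsum F' s.
Proof.
by elim: s F F' => [|x s IH] F F' FF' //=; apply: eq_bigr => k _; rewrite (IH _ _ (fun q => FF' _)).
Qed.

Lemma wsumD F F' s : wsum (fun q => F q + F' q) s = wsum F s + wsum F' s.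
Proof.
elim: s F F' => [|x s IH] F F' //=.
by rewrite -big_split /=; apply: eq_bigr => k _; rewrite IH mulrDr.
Qed.

Lemma wsumZ c F s : wsum (fun q => c * F q) s = c * wsum F s.
Proof.
elim: s F => [|x s IH] F //=.
by rewrite mulr_sumr; apply: eq_bigr => k _; rewrite IH mulrCA.
Qed.

(** Once the occurrence equal to [a] is chosen, the sum over its index collapses to [a.2], leaving
    the coefficient [z y.1.2 a.2] and the sum over the remaining letters. *)
Lemma wsum_splits F a s :
  wsum (fun q => \sum_(y <- splits q | y.1 == a) F y.2) s =
  \sum_(y <- splits s | y.1.1 == a.1) z y.1.2 a.2 * wsum F y.2.
Proof.
elim: s F => [|x s IH] F /=; first by rewrite !big_nil.
rewrite big_cons big_map /=.
transitivity (\sum_k z x.2 k * ((if (x.1, k) == a then wsum F s else 0) +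
   \sum_(y <- splits s | y.1.1 == a.1) z y.1.2 a.2 *
      wsum (fun q => F ((x.1, k) :: q)) y.2)).
  apply: eq_bigr => k _; congr (_ * _).
  rewrite -(IH (fun q => F ((x.1, k) :: q))).
  case: ifP => xa; last first.
    by rewrite add0r; apply: eq_wsum => q; rewrite big_cons big_map /= xa.
  by rewrite -wsumD; apply: eq_wsum => q; rewrite big_cons big_map /= xa.
under [LHS]eq_bigr => k _ do rewrite mulrDr; rewrite big_split /=.
set S := (X in _ + X).
have -> : S = \sum_(y <- splits s | y.1.1 == a.1) z y.1.2 a.2 * wsum F (x :: y.2).
  rewrite /S; under eq_bigr do rewrite mulr_sumr.
  rewrite exchange_big /=; apply: eq_bigr => y _.
  by rewrite mulr_sumr; apply: eq_bigr => k _; rewrite mulrCA.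
clear S IH; case: a => i k0 /=; rewrite (bigD1 k0)//= big1 ?addr0; last first.
  by move=> k kk0; rewrite xpair_eqE (negbTE kk0) andbF mulr0.
by rewrite xpair_eqE eqxx andbT; case: ifP; rewrite ?mulr0 ?add0r.
Qed.

(** A Wick formula for [F] with defect [E] passes to the weighted sums: after exchanging summations,
    a contraction of [x] with [y] carries the covariance of the two linear forms. *)
Lemma wsum_wick F E v x s :
  (forall a q, F (a :: q) = v * \sum_(y <- splits q | y.1 == a) F y.2 + E (a :: q)) ->
  wsum F (x :: s) =
  \sum_(y <- splits s | y.1.1 == x.1) (v * \sum_k z x.2 k * z y.1.2 k) * wsum F y.2
  + wsum E (x :: s).
Proof.
move=> FE /=.
under eq_bigr => k _.
  under eq_wsum do rewrite FE.
  rewrite wsumD wsumZ wsum_splits mulrDr; over.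
rewrite big_split /=; congr (_ + _).
under eq_bigr do rewrite mulrCA mulr_sumr.
rewrite -mulr_sumr exchange_big /= mulr_sumr; apply: eq_bigr => y _.
rewrite -mulrA mulr_suml; congr (_ * _); apply: eq_bigr => k _.
by rewrite mulrA.
Qed.

Lemma wsum_norm_le F s (B : A) : 0 <= B -> (forall b k, `|z b k| <= B) ->
  `|wsum F s| <= B ^+ size s * \sum_(q <- words (enum {: L * K}) (size s)) `|F q|.
Proof.
move=> B0 zB; elim: s F => [|x s IH] F /=; first by rewrite big_seq1 mul1r.
apply: le_trans (ler_norm_sum _ _ _) _.
apply: (@le_trans _ _ (\sum_k B ^+ (size s).+1 *
   \sum_(q <- words (enum {: L * K}) (size s)) `|F ((x.1, k) :: q)|)).
  apply: ler_sum => k _; rewrite normrM exprS -mulrA.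
  by apply: ler_pM => //; exact: IH.
rewrite -mulr_sumr ler_wpM2l ?exprn_ge0//.
pose f i k := \sum_(q <- words (enum {: L * K}) (size s)) `|F ((i, k) :: q)|.
rewrite big_allpairs_dep big_enum /= (_ : \sum_(a in _) _ = \sum_i \sum_k f i k).
  rewrite [leRHS](bigD1 x.1)//= lerDl sumr_ge0// => i _; rewrite sumr_ge0// => k _.
  by rewrite sumr_ge0.
by rewrite pair_bigA; apply: eq_bigr => -[i k] _.
Qed.

End WickSums.

(** * The defect in the Wick formula *)

Section WickDefect.
Context (R : realFieldType) (I : eqType).
Variables (G : seq I -> R) (mu : I -> nat -> R).
Hypothesis G_perm : forall q q', perm_eq q q' -> G q = G q'.
Hypothesis G_split : forall a q,
  G q = mu a (count_mem a q) * G (seq.filter (predC1 a) q).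

(* On [a :: q'] this is the failure of the Wick formula for contracting the
   letter [a] with the occurrences of [a] in [q']; [v] is the variance. *)
Definition wick_error (v : R) (q : seq I) : R :=
  if q is a :: q' then G q - v * \sum_(y <- splits q' | y.1 == a) G y.2 else 0.

(** By [G_perm] and [G_split], every contraction of [a] leaves the same value, so the sum is that
    value times the number of occurrences. If there are none, the truncated predecessor has factor
    0. *)
Lemma wick_errorE v a q : wick_error v (a :: q) =
  (mu a (count_mem a q).+1 - v * (count_mem a q)%:R * mu a (count_mem a q).-1) *
  G (seq.filter (predC1 a) q).
Proof.
rewrite /wick_error [G (a :: q)](G_split a) /= eqxx /= mulrBl; congr (_ - _).
rewrite -!mulrA; congr (v * _).
transitivity (\sum_(y <- splits q | y.1 == a)
   mu a (count_mem a q).-1 * G (seq.filter (predC1 a) q)).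
  rewrite big_seq_cond [RHS]big_seq_cond; apply: eq_bigr => y /andP[yq /eqP ya].
  have yp := splits_perm yq; rewrite ya in yp.
  rewrite (G_split a) -(permP yp (pred1 a)) /= eqxx add1n; congr (_ * _).
  by apply: G_perm; move: (perm_filter (predC1 a) yp); rewrite /= eqxx.
rewrite big_const_seq iter_addr_0 mulr_natl; congr (_ *+ _).
by rewrite -[in RHS](splits_fst q) count_map.
Qed.

(** If the first letter [a] occurs once, its mean 0 kills the defect; if twice, the variance cancels
    it; if more often, some other letter [b] occurs only once and its mean 0 factors out. *)
Lemma wick_error_heavy v q : (forall a, mu a 0 = 1) -> (forall a, mu a 1 = 0) ->
  (forall a, mu a 2 = v) -> ~~ heavy q -> wick_error v q = 0.
Proof.
move=> mu0 mu1 mu2; case: q => [//|a q].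
have [|c2] := leqP (count_mem a q) 1.
  rewrite wick_errorE; case: (count_mem a q) => [|[|//]] _.
    by rewrite mu1 mulr0 mul0r subr0 mul0r.
  by rewrite mu2 mu0 !mulr1 subrr mul0r.
rewrite negb_and => /orP[/allPn[b bq]|]; last by rewrite /= eqxx add1n ltnS c2.
rewrite -leqNgt => b1; have ba : b != a.
  by apply: contraTneq b1 => ->; rewrite /= eqxx add1n -ltnNge ltnS ltnW.
have bq' : b \in q by move: bq; rewrite inE (negbTE ba).
rewrite wick_errorE (G_split b (seq.filter _ _)).
have -> : count_mem b (seq.filter (predC1 a) q) = 1%N.
  apply/eqP; rewrite eqn_leq count_filter; apply/andP; split.
    apply: leq_trans b1; rewrite /= (eq_sym a) (negbTE ba) add0n.
    by apply: sub_count => c /andP[].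
  rewrite -has_count; apply/hasP; exists b => //=.
  by rewrite eqxx.
by rewrite mu1 mul0r mulr0.
Qed.

(** A crude count: there are fewer contractions than letters, and each shortens the word by two. *)
Lemma wick_error_le v (g : nat -> R) q : (forall q, `|G q| <= g (size q)) ->
  `|wick_error v q| <= g (size q) + `|v| * ((size q)%:R * g (size q).-2).
Proof.
move=> Gg; have g0 (h : nat) (q' : seq I) : size q' = h -> 0 <= g h.
  by move=> <-; apply: le_trans (Gg q').
case: q => [|a q] /=; first by rewrite normr0 mul0r mulr0 addr0 (g0 0 [::]).
apply: le_trans (ler_normB _ _) _; rewrite normrM lerD ?Gg// ler_wpM2l//.
apply: le_trans (ler_norm_sum _ _ _) _.
apply: (@le_trans _ _ (\sum_(y <- splits q) g (size q).-1)).
  rewrite big_mkcond big_seq [leRHS]big_seq; apply: ler_sum => y yq.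
  rewrite (splits_size yq) /=; case: ifP => _; first exact: Gg.
  exact: g0.
rewrite big_const_seq iter_addr_0 count_predT size_splits -[leLHS]mulr_natl.
case: q => [|b q]; first by rewrite mul0r mul1r /=(g0 0 [::]).
by apply: ler_wpM2r; [exact: (g0 _ q)|rewrite ler_nat].
Qed.

End WickDefect.

(** * Error estimates for the word recursion *)

Section ComplexBounds.
Context (R : realType).
Local Notation C := R[i].
Local Notation "x %:C" := (real_complex R x) : ring_scope.

Lemma normc_real (x : R) : `|x%:C| = `|x|%:C.
Proof. by rewrite normc_def /= expr0n addr0 sqrtr_sqr. Qed.

(** [Kh] is chosen before [D] and [e], hence will be uniform in the matrix size and the root of
    unity. With [e = 1] it bounds the word sums, with [e] equal to 1/sqrt n it gives their rate of
    convergence. *)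
Lemma splits_rec_bound (B : eqType) (c : nat -> R) (h : nat) : (forall h, 0 <= c h) ->
  exists2 Kh : R, 0 <= Kh & forall (D : seq B -> C) (e : R), 0 <= e ->
    `|D [::]| <= e%:C ->
    (forall x s, `|D (x :: s)| <=
       \sum_(y <- splits s) `|D y.2| + (c (size s).+1 * e)%:C) ->
    forall s, (size s <= h)%N -> `|D s| <= (Kh * e)%:C.
Proof.
move=> c0; elim: h => [|h [Kh Kh0 IH]].
  by exists 1 => // D e e0 D0 _ [|//] _; rewrite mul1r.
have cs0 : 0 <= \sum_(i < h.+2) c i by rewrite sumr_ge0.
have hK0 : 0 <= h%:R * Kh by rewrite mulr_ge0.
(* The terms cover, in order, the empty word, the at most [h] contractions of a longer word, and its
   own error [c], bounded by the sum of all the [c i]. *)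
exists (Kh + h%:R * Kh + \sum_(i < h.+2) c i); first by rewrite !addr_ge0.
move=> D e e0 D0 Drec [|x s] sh.
  by apply: le_trans (IH D e e0 D0 Drec [::] _) _; rewrite // lecR ler_wpM2r// -addrA lerDl addr_ge0.
apply: le_trans (Drec _ _) _.
apply: (@le_trans _ _ (\sum_(y <- splits s) (Kh * e)%:C + (c (size s).+1 * e)%:C)).
  rewrite lerD2r big_seq [leRHS]big_seq; apply: ler_sum => y ys.
  apply: IH => //; move: sh; rewrite /= ltnS (splits_size ys); exact: ltnW.
rewrite -rmorph_sum -rmorphD lecR /= big_const_seq count_predT iter_addr_0 size_splits.
rewrite -[X in X + _ <= _]mulr_natl mulrA -mulrDl ler_wpM2r//.
rewrite lerD//; last first.
  rewrite (bigD1 (Ordinal (sh : (size s).+1 < h.+2)%N))//= lerDl sumr_ge0//.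
by rewrite (@le_trans _ _ (h%:R * Kh))// ?lerDr// ler_wpM2r// ler_nat.
Qed.

Lemma sqrt_natS_ge1 n : 1 <= Num.sqrt n.+1%:R :> R.
Proof. by rewrite -[leLHS]sqrtr1 ler_sqrt// ler1n. Qed.

Section WickSumError.
Context (L : finType) (n : nat).
Variables (z : bool -> 'I_n.+1 -> C) (G : seq (L * 'I_n.+1) -> R)
  (mu : L * 'I_n.+1 -> nat -> R) (g : nat -> R).
Hypothesis G_perm : forall q q', perm_eq q q' -> G q = G q'.
Hypothesis G_split : forall a q,
  G q = mu a (count_mem a q) * G (seq.filter (predC1 a) q).
Hypothesis Gg : forall q, `|G q| <= g (size q).
Hypothesis mu0 : forall a, mu a 0 = 1.
Hypothesis mu1 : forall a, mu a 1 = 0.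
Hypothesis mu2 : forall a, mu a 2 = 1.
Hypothesis z_le : forall b k, `|z b k| <= ((Num.sqrt n.+1%:R)^-1)%:C.

(** The first factor bounds the defect of one word of length [h], the second is the count of heavy
    words with the power of the number of indices removed. *)
Definition error_const (card_L : nat) (g : nat -> R) (h : nat) : R :=
  (`|g h| + h%:R * `|g h.-2|) * (card_L ^ h.-1./2 * h.-1./2 ^ h)%:R.

(** Only heavy words contribute. Each has weight at most [sn ^- h], and there are at most
    [(#|L| * n.+1) ^ r * r ^ h] of them, where [r] is half of [h.-1] rounded down. *)
Lemma wsum_error_le s : s != [::] ->
  `|wsum z (fun q => (wick_error G 1 q)%:C) s| <=
  (error_const #|L| g (size s) * (Num.sqrt n.+1%:R)^-1)%:C.
Proof.
move=> s0; set h := size s; set sn := Num.sqrt n.+1%:R.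
have h0 : (0 < h)%N by rewrite lt0n size_eq0.
have sn1 : 1 <= sn by exact: sqrt_natS_ge1.
have sn0 : 0 < sn by apply: lt_le_trans sn1.
have snV : 0 <= sn^-1 by rewrite invr_ge0 ltW.
pose c := `|g h| + h%:R * `|g h.-2|.
have c0 : 0 <= c by rewrite addr_ge0// mulr_ge0.
pose e := enum {: L * 'I_n.+1}.
(* [L] might be empty; a letter of [s] supplies an element. *)
have [a0 _] : exists a0 : L * 'I_n.+1, true.
  by case: s s0 {h h0 c c0} => // x s _; exists (x.1, ord0).
have errE q : q \in words e h -> `|(wick_error G 1 q)%:C| <= (c * (heavy q)%:R)%:C.
  rewrite mem_words => /andP[/eqP qh _]; rewrite normc_real lecR.
  have [hq|hq] := boolP (heavy q); last by rewrite (wick_error_heavy G_perm G_split)// normr0 mulr0.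
  rewrite mulr1; apply: le_trans (wick_error_le 1 q Gg) _.
  by rewrite normr1 mul1r qh lerD ?ler_norm// ler_wpM2l// ler_norm.
have z_le' b k : `|z b k| <= (sn^-1)%:C by exact: z_le.
have sC0 : 0 <= (sn^-1)%:C by rewrite ler0c.
apply: le_trans (wsum_norm_le _ s sC0 z_le') _; rewrite -/h -/e.
apply: (@le_trans _ _ ((sn^-1) ^+ h * (c * (count (@heavy _) (words e h))%:R))%:C).
  rewrite rmorphM rmorphXn /= ler_wpM2l ?exprn_ge0//.
  have -> : c * (count (@heavy _) (words e h))%:R =
      \sum_(q <- words e h) c * (heavy q)%:R.
    rewrite -mulr_sumr -natr_sum; congr (_ * _%:R).
    by rewrite -sum1_count big_mkcond; apply: eq_bigr => q _; case: (heavy q).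
  rewrite rmorph_sum big_seq [leRHS]big_seq; exact: ler_sum.
rewrite lecR /error_const -/h -/c mulrCA -mulrA ler_wpM2l//.
set r := h.-1./2.
have cw : (count (@heavy _) (words e h) <= (#|L| * n.+1) ^ r * r ^ h)%N.
  have -> : (#|L| * n.+1 = size e)%N by rewrite -cardE card_prod card_ord.
  apply: leq_trans (count_few_letters r h (enum_uniq _) (_ : a0 \in e)); last by rewrite mem_enum.
  rewrite -!size_filter; apply: uniq_leq_size; first by rewrite filter_uniq// words_uniq// enum_uniq.
  move=> q; rewrite !mem_filter => /andP[hq qw]; rewrite qw andbT.
  by move: qw; rewrite mem_words => /andP[/eqP qh _]; rewrite /r -qh heavy_undup.
apply: (@le_trans _ _ (sn^-1 ^+ h * ((#|L| * n.+1) ^ r * r ^ h)%:R)).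
  by rewrite ler_wpM2l ?exprn_ge0// ler_nat.
rewrite expnMn [in leLHS]mulnAC natrM mulrCA ler_wpM2l// natrX.
(* The [r]-th power of [n.+1] is [sn ^+ (2 * r)] with [2 * r <= h.-1], so one factor [sn^-1]
   survives. *)
have -> : n.+1%:R = sn ^+ 2 by rewrite sqr_sqrtr.
rewrite -exprM exprVn ler_pdivrMl ?exprn_gt0//.
have -> : h = (h.-1).+1 by rewrite prednK.
rewrite exprS mulrAC divff ?gt_eqF// mul1r ler_weXn2l//.
by rewrite mul2n -[leqRHS]odd_double_half leq_addl.
Qed.

End WickSumError.
End ComplexBounds.

(** * Expected traces of words *)

Section ComplexExpectation.
Context (R : realType) d (T : measurableType d) (P : probability T R).
Local Notation C := R[i].
Local Notation "x %:C" := (real_complex R x) : ring_scope.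
Implicit Types (f : T -> C).

Definition cintegrable f : Prop :=
  P.-integrable setT (EFin \o (fun w => complex.Re (f w))) /\
  P.-integrable setT (EFin \o (fun w => complex.Im (f w))).

Lemma EcE f : Ec P f = Complex (\int[P]_w complex.Re (f w)) (\int[P]_w complex.Im (f w)).
Proof. by rewrite /Ec unlock [RHS]complexE. Qed.

Lemma cintegrable_sum (I : Type) (r : seq I) (c : I -> C) (f : I -> T -> C) :
  (forall i, cintegrable (f i)) -> cintegrable (fun w => \sum_(i <- r) c i * f i w) /\
  Ec P (fun w => \sum_(i <- r) c i * f i w) = \sum_(i <- r) c i * Ec P (f i).
Proof.
move=> fi; elim: r => [|i r [[IHr IHi] IH]].
  rewrite !EcE; under eq_Rintegral do rewrite big_nil.
  under [X in Complex _ X]eq_Rintegral do rewrite big_nil.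
  rewrite big_nil !Rintegral_cst//= !mul0r; split => //.
  split.
    by under [X in _.-integrable _ X]eq_fun do rewrite /= big_nil; exact: integrable0.
  by under [X in _.-integrable _ X]eq_fun do rewrite /= big_nil; exact: integrable0.
have [fr fI] := fi i.
have iZ (a : R) (g : T -> R) : P.-integrable setT (EFin \o g) ->
    P.-integrable setT (EFin \o (fun w => a * g w)).
  by move=> gi; under [X in _.-integrable _ X]eq_fun do rewrite /= EFinM; exact: integrableZl.
pose a := complex.Re (c i); pose b := complex.Im (c i).
pose S w := \sum_(j <- r) c j * f j w.
have ReE : (fun w => complex.Re (\sum_(j <- i :: r) c j * f j w)) =
    (fun w => (a * complex.Re (f i w) - b * complex.Im (f i w)) + complex.Re (S w)).
  apply/funext => w; rewrite big_cons -/(S w) /a /b.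
  by case: (c i) (f i w) (S w) => ? ? [? ?] [? ?].
have ImE : (fun w => complex.Im (\sum_(j <- i :: r) c j * f j w)) =
    (fun w => (a * complex.Im (f i w) + b * complex.Re (f i w)) + complex.Im (S w)).
  apply/funext => w; rewrite big_cons -/(S w) /a /b.
  by case: (c i) (f i w) (S w) => ? ? [? ?] [? ?].
have i1 : P.-integrable setT (EFin \o (fun w => a * complex.Re (f i w) - b * complex.Im (f i w))).
  under [X in _.-integrable _ X]eq_fun do rewrite /= EFinB.
  by apply: integrableB => //; exact: iZ.
have i2 : P.-integrable setT (EFin \o (fun w => a * complex.Im (f i w) + b * complex.Re (f i w))).
  under [X in _.-integrable _ X]eq_fun do rewrite /= EFinD.
  by apply: integrableD => //; exact: iZ.
split.
  split.
    rewrite ReE; under [X in _.-integrable _ X]eq_fun do rewrite /= EFinD.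
    exact: integrableD.
  rewrite ImE; under [X in _.-integrable _ X]eq_fun do rewrite /= EFinD.
  exact: integrableD.
rewrite big_cons -IH !EcE ReE ImE [X in Complex X _ = _]RintegralD//.
rewrite [X in Complex _ X = _]RintegralD// RintegralB//; try exact: iZ.
rewrite [X in Complex _ (X + _) = _]RintegralD//; try exact: iZ.
rewrite !RintegralZl//.
by rewrite /a /b; case: (c i).
Qed.

Lemma Ec_real (h : T -> R) : P.-integrable setT (EFin \o h) ->
  cintegrable (fun w => (h w)%:C) /\ Ec P (fun w => (h w)%:C) = (\int[P]_w h w)%:C.
Proof.
move=> hi; rewrite EcE /= Rintegral_cst//= mul0r; split=> //; split => //=.
exact: integrable0.
Qed.

(* The factor [h] in the proof carries the variables already extracted. *)
Lemma Ec_prod_wsum (L K : finType) (z : bool -> K -> C) (Y : L * K -> T -> R) (M : nat -> R)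
    (s : seq (L * bool)) :
  (forall a, moments_le P M (Y a)) ->
  cintegrable (fun w => \prod_(x <- s) \sum_k z x.2 k * (Y (x.1, k) w)%:C) /\
  Ec P (fun w => \prod_(x <- s) \sum_k z x.2 k * (Y (x.1, k) w)%:C) =
  wsum z (fun q => (\int[P]_w \prod_(a <- q) Y a w)%:C) s.
Proof.
move=> MY.
suff H (h : T -> R) (N : nat -> R) : moments_le P N h ->
    cintegrable (fun w => (h w)%:C * \prod_(x <- s) \sum_k z x.2 k * (Y (x.1, k) w)%:C) /\
    Ec P (fun w => (h w)%:C * \prod_(x <- s) \sum_k z x.2 k * (Y (x.1, k) w)%:C) =
    wsum z (fun q => (\int[P]_w (h w * \prod_(a <- q) Y a w))%:C) s.
  have := H _ _ (moments_le1 P).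
  under [X in cintegrable X]eq_fun do rewrite mul1r.
  under [X in Ec P X]eq_fun do rewrite mul1r.
  move=> [? ->]; split=> //; apply: eq_wsum => q.
  by under eq_Rintegral do rewrite mul1r.
elim: s h N => [|x s IH] h N Nh.
  have [h1 h2] := Ec_real (moments_le_integrable Nh).
  under [X in cintegrable X]eq_fun do rewrite big_nil mulr1.
  under [X in Ec P X]eq_fun do rewrite big_nil mulr1.
  split=> //=; rewrite h2; congr (_%:C).
  by apply: eq_Rintegral => w _; rewrite big_nil mulr1.
have E : (fun w => (h w)%:C * \prod_(y <- x :: s) \sum_k z y.2 k * (Y (y.1, k) w)%:C) =
   (fun w => \sum_k z x.2 k * ((h w * Y (x.1, k) w)%:C *
        \prod_(y <- s) \sum_k z y.2 k * (Y (y.1, k) w)%:C)).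
  apply/funext => w; rewrite big_cons mulrA mulr_sumr mulr_suml.
  by apply: eq_bigr => k _; rewrite rmorphM /=; ring.
have IHk k := IH _ _ (moments_leM Nh (MY (x.1, k))).
have [c1 c2] := @cintegrable_sum K (index_enum K) (z x.2) _ (fun k => (IHk k).1).
rewrite E; split=> //; rewrite c2 /=; apply: eq_bigr => k _.
rewrite (IHk k).2; congr (_ * _); apply: eq_wsum => q; congr (_%:C).
by apply: eq_Rintegral => w _; rewrite big_cons mulrA.
Qed.

End ComplexExpectation.

(** * Matrices exchanging two vectors; Fourier vectors *)

Section AlternatingWords.
Context (R : realType) (m : nat).
Local Notation C := R[i].

(** The boolean records which of the two exchanged vectors a letter acts on, starting from the
    vector [b]. *)
Fixpoint alt (b : bool) (s : seq 'I_m) : seq ('I_m * bool) :=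
  if s is i :: s' then (i, b) :: alt (~~ b) s' else [::].

Lemma size_alt b s : size (alt b s) = size s.
Proof. by elim: s b => //= i s IH b; rewrite IH. Qed.

Definition word_mx (k : nat) (A : 'I_m -> 'M[C]_k) (s : seq 'I_m) : 'M[C]_k :=
  foldr (fun i M => A i *m M) 1%:M s.

(** Shared by both models: [v] is a pair of Fourier vectors or the basis of the plane. Row vectors
    let the first letter of the word act first. *)
Lemma mul_word_mx (k : nat) (A : 'I_m -> 'M[C]_k) (v : bool -> 'rV[C]_k)
    (D : 'I_m * bool -> C) b s :
  (forall b i, v b *m A i = D (i, b) *: v (~~ b)) ->
  v b *m word_mx A s = (\prod_(x <- alt b s) D x) *: v (b (+) odd (size s)).
Proof.
move=> vA; elim: s b => [|i s IH] b /=.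
  by rewrite mulmx1 big_nil scale1r addbF.
rewrite /word_mx /= mulmxA vA -scalemxAl -/(word_mx A s) IH big_cons scalerA.
by rewrite addNb addbN.
Qed.

Lemma unity_roots (N : nat) : (0 < N)%N -> exists rs : N.-tuple C,
  uniq rs /\ forall l, tnth rs l ^+ N = 1.
Proof.
move=> N0.
have [rs rsE] := closed_field_poly_normal ('X^N - 1 : {poly C}).
move: rsE; rewrite (monicP _) ?monicXnsubC// scale1r => rsE.
have rsN : size rs == N.
  by have := size_XnsubC (1 : C) N0; rewrite rsE size_prod_XsubC => -[->].
exists (Tuple rsN); split.
  rewrite /= -separable_prod_XsubC -rsE separable_Xn_sub_1 ?pnatr_eq0 -?lt0n//.
move=> l; have : root ('X^N - 1 : {poly C}) (tnth (Tuple rsN) l).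
  by rewrite rsE root_prod_XsubC mem_tnth.
by rewrite rootE !hornerE subr_eq0 => /eqP.
Qed.

Lemma sum_unity_root (N : nat) (y : C) : y ^+ N = 1 ->
  \sum_(k < N) y ^+ k = if y == 1 then N%:R else 0.
Proof.
move=> yN; case: eqVneq => [->|y1].
  by under eq_bigr do rewrite expr1n; rewrite sumr_const card_ord.
apply: (mulfI (_ : y - 1 != 0)); first by rewrite subr_eq0.
by rewrite -subrX1 yN subrr mulr0.
Qed.

Lemma norm_unity_root (N : nat) (y : C) : (0 < N)%N -> y ^+ N = 1 -> `|y| = 1.
Proof.
move=> N0 yN; apply/eqP; rewrite -(pexpr_eq1 N0)// -normrX yN.
by rewrite normr1.
Qed.

Definition chi (y : C) (b : bool) : C := if b then y else y^-1.

Definition chi_row (N : nat) (y : C) (b : bool) : 'rV[C]_N := \row_r chi y b ^+ r.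

Lemma chiX (N : nat) y b : y ^+ N = 1 -> chi y b ^+ N = 1.
Proof. by case: b => //= yN; rewrite exprVn yN invr1. Qed.

Lemma chiN y b : chi y (~~ b) = (chi y b)^-1.
Proof. by case: b; rewrite /= ?invrK. Qed.

(* [V] below is the Fourier matrix up to scaling and ordering of the roots; both
   [V *m W] and [W *m V] are scalar, so no primitive root is needed. *)
Lemma trace_unity_roots (N : nat) (rs : N.-tuple C) (M : 'M[C]_N) b :
  (0 < N)%N -> uniq rs -> (forall l, tnth rs l ^+ N = 1) ->
  \tr M = N%:R^-1 * \sum_(l < N) \sum_(r < N)
    (chi_row N (tnth rs l) b *m M) 0 r * chi (tnth rs l) (~~ b) ^+ r.
Proof.
move=> N0 urs rsN.
pose V := \matrix_(l < N, r < N) chi (tnth rs l) b ^+ r.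
pose W := \matrix_(r < N, l < N) chi (tnth rs l) (~~ b) ^+ r.
have rs0 l : tnth rs l != 0.
  by apply: contra_eqN (rsN l) => /eqP ->; rewrite expr0n (gtn_eqF N0) eq_sym oner_eq0.
have NC : N%:R != 0 :> C by rewrite pnatr_eq0 -lt0n.
have VW : V *m W = N%:R%:M.
  apply/matrixP => l l'; rewrite !mxE.
  under eq_bigr do rewrite !mxE -exprMn.
  rewrite sum_unity_root ?exprMn ?chiX ?mulr1//.
  have chi0 : chi (tnth rs l') b != 0 by case: (b); rewrite //= invr_eq0.
  rewrite chiN (can2_eq (mulfVK chi0) (mulfK chi0)) mul1r.
  have -> : (chi (tnth rs l) b == chi (tnth rs l') b) = (l == l').
    rewrite -(inj_eq (tuple_uniqP _ urs)).
    by case: (b) => //=; rewrite (inj_eq invr_inj).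
  by case: (l == l').
have WV : (N%:R^-1 *: W) *m V = 1%:M.
  by apply: mulmx1C; rewrite -scalemxAr VW scale_scalar_mx mulVf.
rewrite -[M in LHS]mulmx1 -WV mulmxA mxtrace_mulC -scalemxAr -scalemxAr mxtraceZ.
congr (_ * _); apply: eq_bigr => l _; rewrite mulmxA mxE.
apply: eq_bigr => r _; rewrite [W _ _]mxE; congr (_ * _).
by rewrite !mxE; apply: eq_bigr => k _; rewrite !mxE.
Qed.

End AlternatingWords.

(** * Reverse circulant matrices on Fourier vectors *)

Section ReverseCirculantWords.
Context (R : realType) (m n : nat).
Local Notation C := R[i].
Local Notation "x %:C" := (real_complex R x) : ring_scope.
Local Notation N := n.+1.
Let sn : R := Num.sqrt N%:R.

Definition zchi (y : C) (b : bool) (k : 'I_N) : C := chi y b ^+ k * (sn^-1)%:C.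

Lemma norm_zchi y b k : y ^+ N = 1 -> `|zchi y b k| <= (sn^-1)%:C.
Proof.
move=> yN; rewrite /zchi normrM normrX (@norm_unity_root _ N)//; last exact: chiX.
by rewrite expr1n mul1r normc_real ger0_norm// invr_ge0 sqrtr_ge0.
Qed.

Lemma sqr_snV : (sn^-1)%:C * (sn^-1)%:C = N%:R^-1 :> C.
Proof.
by rewrite -rmorphM -invfM -expr2 sqr_sqrtr//= fmorphV /= rmorph_nat.
Qed.

Lemma zchi_pair y b b' : y ^+ N = 1 ->
  \sum_k zchi y b k * zchi y b' k = if b == b' then (y ^+ 2 == 1)%:R else 1.
Proof.
move=> yN; have y0 : y != 0.
  by apply: contra_eqN yN => /eqP ->; rewrite expr0n eq_sym oner_eq0.
transitivity (N%:R^-1 * \sum_(k < N) (chi y b * chi y b') ^+ k).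
  by rewrite mulr_sumr; apply: eq_bigr => k _; rewrite /zchi mulrACA sqr_snV exprMn mulrC.
rewrite sum_unity_root; last by rewrite exprMn !chiX ?mulr1.
have NC : N%:R != 0 :> C by rewrite pnatr_eq0.
have -> : (chi y b * chi y b' == 1) = (b != b') || (y ^+ 2 == 1).
  case: b b' => [] [] /=; rewrite ?mulfV ?mulVf ?eqxx -?expr2//.
  by rewrite exprVn invr_eq1.
by case: (b == b'); case: (y ^+ 2 == 1); rewrite /= ?mulr0 ?mulVf.
Qed.

Section Action.
Context d (T : measurableType d) (X : 'I_m -> nat -> T -> R) (w : T).

(** The substitution [k = r + s] modulo [N] turns [chi ^+ r] into [chi ^+ k] times [chi ^- s]: the
    column index enters through the inverse root, whence the exchange. *)
Lemma chi_row_RCmat y b i : y ^+ N = 1 ->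
  chi_row N y b *m RCmat (X i) N w =
  (\sum_k zchi y b k * (X i k.+1 w)%:C) *: chi_row N y (~~ b).
Proof.
move=> yN; apply/rowP => s; rewrite !mxE mulr_suml [RHS](reindex_inj (addIr s)) /=.
apply: eq_bigr => r _; rewrite !mxE.
(* Choosing representatives in 1..N instead of 0..n amounts to a shift by one, including the residue
   0, represented by [N]. *)
have -> : rc_index r s = ((r + s) %% N).+1.
  rewrite /rc_index addn1.
  have := ltn_pmod (r + s) (ltn0Sn n); rewrite ltnS leq_eqVlt => /predU1P[rs|rs].
    by rewrite -addn1 -modnDml rs addn1 modnn eqxx.
  by rewrite -addn1 -modnDml addn1 modn_small// ltnS.
have c0 : chi y b != 0.
  apply: contra_eqN (chiX b yN) => /eqP ->; rewrite expr0n.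
  by rewrite eq_sym oner_eq0.
rewrite /zchi chiN -[(r + s)%R : nat]/((r + s) %% N)%N.
rewrite (expr_mod _ (chiX b yN)) exprD exprVn rmorphM /=.
by field; rewrite expf_neq0//= fmorph_eq0 gt_eqF// sqrtr_gt0.
Qed.

(** After an even word the Fourier vector returns and pairs with its dual to [N]; after an odd one
    the pairing is a geometric sum in a power of [y ^+ 2] or its inverse, nonzero only if
    [y ^+ 2 = 1]. *)
Lemma trace_RCmat_word (rs : N.-tuple C) b s :
  uniq rs -> (forall l, tnth rs l ^+ N = 1) ->
  \tr (word_mx (fun i => RCmat (X i) N w) s) = \sum_(l < N)
    (~~ odd (size s) || (tnth rs l ^+ 2 == 1))%:R *
    \prod_(x <- alt b s) \sum_k zchi (tnth rs l) x.2 k * (X x.1 k.+1 w)%:C.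
Proof.
move=> urs rsN; rewrite (trace_unity_roots _ b _ urs rsN)// mulr_sumr.
apply: eq_bigr => l _; set y := tnth rs l; have yN : y ^+ N = 1 by exact: rsN.
have y0 : y != 0.
  by apply: contra_eqN yN => /eqP ->; rewrite expr0n eq_sym oner_eq0.
have act b' i := chi_row_RCmat b' i yN.
rewrite (mul_word_mx (D := fun x => \sum_k zchi y x.2 k * (X x.1 k.+1 w)%:C) b s act).
set p := \prod_(x <- _) _.
transitivity (p * (N%:R^-1 * \sum_(r < N) (chi y (b (+) odd (size s)) * chi y (~~ b)) ^+ r)).
  rewrite mulrCA; congr (_ * _); rewrite mulr_sumr; apply: eq_bigr => r _.
  by rewrite !mxE exprMn mulrA.
rewrite mulrC; congr (_ * _); rewrite sum_unity_root; last by rewrite exprMn !chiX ?mulr1.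
have NC : N%:R != 0 :> C by rewrite pnatr_eq0.
have -> : (chi y (b (+) odd (size s)) * chi y (~~ b) == 1) =
    ~~ odd (size s) || (y ^+ 2 == 1).
  by case: (odd _) (b) => [] [] /=; rewrite ?mulfV ?mulVf ?eqxx -?expr2// exprVn invr_eq1.
by case: ifP => _; rewrite ?mulr0 ?mulVf.
Qed.

End Action.
End ReverseCirculantWords.

(** * The two-by-two Gaussian matrices on basis vectors *)

Section TwoByTwoWords.
Context (R : realType) (m : nat).
Local Notation C := R[i].
Local Notation "x %:C" := (real_complex R x) : ring_scope.

(** The coefficients of the real part ([c] true) and the imaginary part ([c] false) in eta ([b]
    true) or its conjugate ([b] false). *)
Definition zgauss (b c : bool) : C :=
  if c then 1 else if b then Complex 0 1 else Complex 0 (-1).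

(** That is, eta squared has mean 0 and its squared modulus mean 1: the same contractions as in
    [zchi_pair] when [y ^+ 2 != 1]. *)
Lemma zgauss_pair b b' : 2^-1 * \sum_c zgauss b c * zgauss b' c = (b != b')%:R.
Proof.
rewrite big_bool /= mulr1.
have ii : Complex 0 1 * Complex 0 1 = -1 :> C by rewrite -expr2 sqr_i.
have iN : Complex 0 (-1) = - Complex 0 1 :> C by apply/eqP; rewrite eq_complex /= oppr0 !eqxx.
have two : 2%:R != 0 :> C by rewrite pnatr_eq0.
by case: b b' => [] [] /=; rewrite ?iN ?mulNr ?mulrN ?opprK ?ii ?opprK ?subrr ?mulr0// mulVf.
Qed.

Context d (T : measurableType d) (U V : 'I_m -> T -> R) (w : T).
Let A i := amat (fun w => Complex (U i w) (V i w)) w.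
Let v (b : bool) : 'rV[C]_2 := delta_mx 0 (if b then ord0 else ord_max).

Lemma delta_row_amat b i :
  v b *m A i = (\sum_c zgauss b c * (if c then U i w else V i w)%:C) *: v (~~ b).
Proof.
have E : zgauss b true * (U i w)%:C + zgauss b false * (V i w)%:C =
    if b then Complex (U i w) (V i w) else conjc (Complex (U i w) (V i w)).
  by case: b; apply/eqP; rewrite eq_complex /= !(mul0r, mul1r, mulN1r, mulNr, subr0, add0r, addr0, mulr0, oppr0) !eqxx.
rewrite big_bool /= E; apply/rowP => j; rewrite /v -rowE !mxE.
case: j => [[|[|//]] j2]; case: b {E};
  by rewrite -!val_eqE /= ?mulr0 ?mulr1.
Qed.

Lemma trace_amat_word s :
  \tr (word_mx A s) = \sum_b (~~ odd (size s))%:R *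
    \prod_(x <- alt b s) \sum_c zgauss x.2 c * (if c then U x.1 w else V x.1 w)%:C.
Proof.
pose D (x : 'I_m * bool) : C := \sum_c zgauss x.2 c * (if c then U x.1 w else V x.1 w)%:C.
have act b i : v b *m A i = D (i, b) *: v (~~ b) by exact: delta_row_amat.
have dE b : v b *m word_mx A s *m (v b)^T =
    ((~~ odd (size s))%:R * \prod_(x <- alt b s) D x)%:M.
  rewrite (mul_word_mx b s act) -scalemxAl [X in _ *: X](_ : _ = (~~ odd (size s))%:R%:M).
    by rewrite scale_scalar_mx mulrC.
  apply/matrixP => i j; rewrite !ord1 !mxE (bigD1 (if b then ord0 else ord_max)) //= big1.
    by case: (odd (size s)); case: (b); rewrite /= !mxE /= ?(mulr1, mul0r, mulr1n, mul0rn, addr0).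
  by move=> k; rewrite !mxE eqxx => /negbTE ->; rewrite mulr0.
transitivity (\sum_b (v b *m word_mx A s *m (v b)^T) 0 0).
  rewrite big_bool /= /v /mxtrace !big_ord_recl big_ord0 addr0 !trmx_delta.
  rewrite -!rowE -!colE !mxE; congr (_ + word_mx A s _ _); exact: val_inj.
by apply: eq_bigr => b _; rewrite dE mxE eqxx mulr1n.
Qed.

End TwoByTwoWords.

(** * Convergence *)

Section WordLimits.
Context (R : realType) (m : nat).
Local Notation C := R[i].
Local Notation "x %:C" := (real_complex R x) : ring_scope.

Lemma phi_nceval_rand d (T : measurableType d) (P : probability T R) k
    (Q : ncpoly R m) (A : 'I_m -> T -> 'M[C]_k) :
  (forall s, cintegrable P (fun w => \tr (word_mx (fun i => A i w) s))) ->
  phi P (nceval_rand Q A) =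
  \sum_(t <- Q) t.1 * phi P (fun w => word_mx (fun i => A i w) t.2).
Proof.
move=> iA; rewrite /phi.
have -> : (fun w => \tr (nceval_rand Q A w)) =
    (fun w => \sum_(t <- Q) t.1 * \tr (word_mx (fun i => A i w) t.2)).
  apply/funext => w; rewrite /nceval_rand /nceval raddf_sum /=.
  by apply: eq_bigr => t _; rewrite mxtraceZ.
have [_ ->] := @cintegrable_sum _ _ _ P _ Q (fun t => t.1) _ (fun t => iA t.2).
by rewrite mulr_sumr; apply: eq_bigr => t _; rewrite mulrCA.
Qed.

(** * Limits of reverse circulant words *)

Section ReverseCirculantSide.
Context d (T : measurableType d) (P : probability T R) (X : 'I_m -> nat -> T -> R).
Hypothesis mX : forall i j, measurable_fun setT (X i j).
Hypothesis X_fam : indep_families P X.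
Hypothesis X_RV : forall i, indep_RVs P (X i).
Hypothesis X1 : forall i j, \int[P]_w X i j w = 0.
Hypothesis X2 : forall i j, \int[P]_w (X i j w ^+ 2) = 1.
Variable M : nat -> R.
Hypothesis MX : forall i j, moments_le P M (X i j).

Let f n (a : 'I_m * 'I_n.+1) : 'I_m * nat := (a.1, a.2.+1).
Let G n (q : seq ('I_m * 'I_n.+1)) : R := mixed_moment P X (map (@f n) q).
Let mu n (a : 'I_m * 'I_n.+1) p : R := \int[P]_w (X a.1 a.2.+1 w ^+ p).

Let f_inj n : injective (@f n).
Proof. by move=> [i k] [i' k'] [-> kk]; congr (_, _); apply: val_inj. Qed.

Let G_perm n (q q' : seq ('I_m * 'I_n.+1)) : perm_eq q q' -> G q = G q'.
Proof.
move=> qq; congr Rintegral; apply/funext => w.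
by apply: perm_big; exact: perm_map.
Qed.

Let G_split n (a : 'I_m * 'I_n.+1) q :
  G q = mu a (count_mem a q) * G (seq.filter (predC1 a) q).
Proof.
rewrite /G (mixed_moment_split mX X_fam X_RV MX (f a)); congr (_ * _).
  rewrite /mu; congr (Rintegral _ _ _); apply/funext => w; congr (_ ^+ _).
  by rewrite count_map; apply: eq_count => b /=; rewrite (inj_eq (@f_inj n)).
congr (mixed_moment _ _ _); rewrite filter_map; congr map.
Qed.

Let g h := prod_bound M h 1.

Let G_le n (q : seq ('I_m * 'I_n.+1)) : `|G q| <= g (size q).
Proof. by rewrite /g -(size_map (@f n)); apply: mixed_moment_le MX _. Qed.

Let mu0 n (a : 'I_m * 'I_n.+1) : mu a 0 = 1.
Proof.
rewrite /mu; under eq_Rintegral do rewrite expr0.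
by rewrite Rintegral_cst//= probability_setT /= mulr1.
Qed.

Let mu1 n (a : 'I_m * 'I_n.+1) : mu a 1 = 0. Proof. exact: X1. Qed.
Let mu2 n (a : 'I_m * 'I_n.+1) : mu a 2 = 1. Proof. exact: X2. Qed.

(** By [Ec_prod_wsum], the expectation of the product of the Fourier coefficients of [X] along
    [s]. *)
Definition rc_word_sum n (y : C) (s : seq ('I_m * bool)) : C :=
  wsum (@zchi R n y) (fun q => (G q)%:C) s.

Let err n (y : C) s := wsum (@zchi R n y) (fun q => (wick_error (@G n) 1 q)%:C) s.

Lemma rc_word_sum_rec n y x s : y ^+ n.+1 = 1 ->
  rc_word_sum n y (x :: s) =
  \sum_(z <- splits s | z.1.1 == x.1)
    (if x.2 == z.1.2 then (y ^+ 2 == 1)%:R else 1) * rc_word_sum n y z.2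
  + err n y (x :: s).
Proof.
move=> yn; rewrite /rc_word_sum (wsum_wick (v := 1) _
  (E := fun q => (wick_error (@G n) 1 q)%:C)).
  by congr (_ + _); apply: eq_bigr => z _; rewrite mul1r zchi_pair.
move=> a q /=; rewrite mul1r -rmorph_sum -rmorphD /=; congr (_%:C).
by rewrite mul1r addrC subrK.
Qed.

Let cerr h := error_const #|'I_m| g h.

Let cerr0 h : 0 <= cerr h.
Proof. by rewrite /cerr /error_const mulr_ge0// addr_ge0// mulr_ge0. Qed.

Let err_le n y s : y ^+ n.+1 = 1 -> s != [::] ->
  `|err n y s| <= (cerr (size s) * (Num.sqrt n.+1%:R)^-1)%:C.
Proof.
move=> yn s0; apply: (wsum_error_le (mu := @mu n)) => //.
- exact: G_perm.
- by move=> b k; exact: norm_zchi.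
Qed.

Let ler_splits_sum (W W' : seq ('I_m * bool) -> C) (p : 'I_m * bool -> C) (x : 'I_m * bool)
    (s : seq ('I_m * bool)) (E : C) (e : R) :
  (forall z, `|p z| <= 1) ->
  W (x :: s) = \sum_(z <- splits s | z.1.1 == x.1) p z.1 * W' z.2 + E -> `|E| <= e%:C ->
  `|W (x :: s)| <= \sum_(z <- splits s) `|W' z.2| + e%:C.
Proof.
move=> p1 -> Ee; apply: le_trans (ler_normD _ _) _; apply: lerD => //.
apply: le_trans (ler_norm_sum _ _ _) _; rewrite big_mkcond; apply: ler_sum => z _.
by case: ifP => // _; rewrite normrM ler_piMl.
Qed.

Lemma rc_word_sum_bound h : exists2 Kh : R, 0 <= Kh &
  forall n y s, y ^+ n.+1 = 1 -> (size s <= h)%N -> `|rc_word_sum n y s| <= Kh%:C.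
Proof.
have [Kh Kh0 H] := @splits_rec_bound R ('I_m * bool)%type cerr h cerr0.
exists Kh => // n y s yn sh; rewrite -[Kh]mulr1; apply: H => //.
- by rewrite /rc_word_sum /= /G mixed_moment_nil normr1.
move=> x s'; apply: (@ler_splits_sum _ (rc_word_sum n y)
  (fun z => if x.2 == z.2 then (y ^+ 2 == 1)%:R else 1) _ _ (err n y (x :: s'))).
- move=> z; case: ifP => _; last by rewrite normr1.
  by case: (y ^+ 2 == 1); rewrite ?normr0 ?normr1 ?ler01.
- exact: rc_word_sum_rec.
apply: le_trans (err_le yn _) _ => //; rewrite lecR ler_wpM2l//.
by rewrite invf_le1 ?sqrtr_gt0// sqrt_natS_ge1.
Qed.

Variable W : seq ('I_m * bool) -> C.
Hypothesis W0 : W [::] = 1.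
Hypothesis W_rec : forall x s, W (x :: s) =
  \sum_(z <- splits s | z.1.1 == x.1) (x.2 != z.1.2)%:R * W z.2.

(** [W] stands for the Gaussian word sum, known only through its recursion. For [y ^+ 2 != 1] the
    contractions agree, so the difference obeys the same recursion with only the error term as
    source. *)
Lemma rc_word_sum_cvg h : exists2 Kh : R, 0 <= Kh &
  forall n y s, y ^+ n.+1 = 1 -> y ^+ 2 != 1 -> (size s <= h)%N ->
    `|rc_word_sum n y s - W s| <= (Kh * (Num.sqrt n.+1%:R)^-1)%:C.
Proof.
have [Kh Kh0 H] := @splits_rec_bound R ('I_m * bool)%type cerr h cerr0.
exists Kh => // n y s yn y2 sh.
apply: (H (fun s => rc_word_sum n y s - W s)) => //.
- by rewrite /rc_word_sum /= /G mixed_moment_nil W0 subrr normr0 ler0c invr_ge0 sqrtr_ge0.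
move=> x s'.
apply: (@ler_splits_sum (fun s => rc_word_sum n y s - W s)
   (fun s => rc_word_sum n y s - W s) (fun z => (x.2 != z.2)%:R) x s' (err n y (x :: s'))).
- by move=> z; case: (_ != _); rewrite ?normr0 ?normr1 ?ler01.
- rewrite rc_word_sum_rec// W_rec addrAC -sumrB; congr (_ + _).
  by apply: eq_bigr => z _; rewrite mulrBr (negbTE y2); case: (_ == _).
- exact: err_le.
Qed.

Lemma rc_trace_expect n b s (rs : n.+1.-tuple C) :
  uniq rs -> (forall l, tnth rs l ^+ n.+1 = 1) ->
  let tr w := \tr (word_mx (fun i => RCmat (X i) n.+1 w) s) in
  cintegrable P tr /\
  Ec P tr = \sum_(l < n.+1) (~~ odd (size s) || (tnth rs l ^+ 2 == 1))%:R *
    rc_word_sum n (tnth rs l) (alt b s).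
Proof.
move=> urs rsN tr.
have -> : tr = fun w => \sum_(l < n.+1) (~~ odd (size s) || (tnth rs l ^+ 2 == 1))%:R *
    \prod_(x <- alt b s) \sum_(k < n.+1) zchi (tnth rs l) x.2 k * (X x.1 k.+1 w)%:C.
  by apply/funext => w; exact: trace_RCmat_word.
have H l := Ec_prod_wsum (@zchi R n (tnth rs l)) (alt b s)
  (fun a : 'I_m * 'I_n.+1 => MX a.1 a.2.+1).
have [c1 ->] := @cintegrable_sum _ _ _ P _ (index_enum 'I_n.+1)
   (fun l => (~~ odd (size s) || (tnth rs l ^+ 2 == 1))%:R) _ (fun l => (H l).1).
split=> //; apply: eq_bigr => l _; congr (_ * _); rewrite (H l).2.
apply: eq_wsum => q; congr (_%:C); congr Rintegral; apply/funext => w.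
by rewrite big_map.
Qed.

Lemma card_sqr1 n (rs : n.-tuple C) : uniq rs ->
  (#|[pred l | (tnth rs l ^+ 2 == 1)%R]| <= 2)%N.
Proof.
move=> urs; rewrite cardE -(size_map (tnth rs)).
apply: (@uniq_leq_size _ _ [:: 1 : C; -1]).
  by rewrite map_inj_uniq ?enum_uniq//; exact/tuple_uniqP.
move=> y /mapP[l]; rewrite mem_enum inE => + ->.
by rewrite sqrf_eq1 !inE.
Qed.

Lemma phi_rc_word_cvg b s : exists2 Kh : R, 0 <= Kh & forall n,
  `|phi P (fun w => word_mx (fun i => RCmat (X i) n.+1 w) s) -
    (~~ odd (size s))%:R * W (alt b s)| <= (Kh * (Num.sqrt n.+1%:R)^-1)%:C.
Proof.
have [K1 K10 H1] := rc_word_sum_bound (size s).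
have [K2 K20 H2] := rc_word_sum_cvg (size s).
have [w0 w00 w0E] : exists2 w0 : R, 0 <= w0 & w0%:C = `|W (alt b s)|.
  have wE : (complex.Re `|W (alt b s)|)%:C = `|W (alt b s)| by rewrite RRe_real// normr_real.
  by exists (complex.Re `|W (alt b s)|) => //; rewrite -ler0c wE.
(* [K2] serves the generic roots; the at most two roots with square 1 each differ from the limit by
   at most [K1 + w0], apart from the [K2] term. *)
exists (K2 + 2 * (K1 + w0)); first by rewrite !(addr_ge0, mulr_ge0).
move=> n; have [rs [urs rsN]] := unity_roots R (ltn0Sn n).
set sn := Num.sqrt n.+1%:R.
have sn1 : 1 <= sn by exact: sqrt_natS_ge1.
have sn0 : 0 < sn by apply: lt_le_trans sn1.
have [_ trE] := rc_trace_expect b s urs rsN.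
have NC : n.+1%:R != 0 :> C by rewrite pnatr_eq0.
pose term l := (~~ odd (size s) || (tnth rs l ^+ 2 == 1))%:R *
  rc_word_sum n (tnth rs l) (alt b s) - (~~ odd (size s))%:R * W (alt b s).
have -> : phi P (fun w => word_mx (fun i => RCmat (X i) n.+1 w) s) -
    (~~ odd (size s))%:R * W (alt b s) = n.+1%:R^-1 * \sum_l term l.
  rewrite /phi trE sumrB mulrBr sumr_const card_ord -[in RHS](mulr_natl (_ * W _)).
  by rewrite mulKf.
have term_le l : `|term l| <=
    (K2 * sn^-1 + if tnth rs l ^+ 2 == 1 then K1 + w0 else 0)%:C.
  rewrite /term; case: eqVneq => [y1|y1]; last first.
    rewrite orbF addr0; case: (odd _); first by rewrite !mul0r subr0 normr0 ler0c mulr_ge0// invr_ge0 ltW.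
    by rewrite !mul1r H2// ?size_alt.
  rewrite orbT mul1r; apply: le_trans (ler_normB _ _) _.
  rewrite [leRHS](_ : _ = (K2 * sn^-1)%:C + (K1%:C + w0%:C)); last by rewrite !rmorphD.
  rewrite w0E -[leLHS]add0r lerD//.
    by rewrite ler0c mulr_ge0// invr_ge0 ltW.
  rewrite lerD//; first by rewrite H1// size_alt.
  by case: (odd _); rewrite ?mul0r ?mul1r ?normr0.
rewrite normrM normfV normr_nat.
rewrite ler_pdivrMl ?ltr0n//.
apply: le_trans (ler_norm_sum _ _ _) _.
apply: (@le_trans _ _ (\sum_(l < n.+1)
    (K2 * sn^-1 + if tnth rs l ^+ 2 == 1 then K1 + w0 else 0)%:C)).
  by apply: ler_sum => l _; exact: term_le.
rewrite -rmorph_sum -[n.+1%:R](rmorph_nat (real_complex R)) -rmorphM lecR /=.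
rewrite big_split /= sumr_const card_ord -[_ *+ n.+1]mulr_natl mulrDl mulrDr lerD2l.
rewrite -big_mkcond sumr_const mulrA -[_ *+ _]mulr_natl.
have -> : n.+1%:R * (2 * (K1 + w0)) * sn^-1 = sn * (2 * (K1 + w0)).
  rewrite -[n.+1%:R](@sqr_sqrtr R)// -/sn expr2.
  by field; rewrite gt_eqF.
rewrite mulrA; apply: ler_wpM2r; first by rewrite addr_ge0.
apply: (@le_trans _ _ 2); first by rewrite (ler_nat _ _ 2) card_sqr1.
by rewrite ler_peMl.
Qed.

End ReverseCirculantSide.
End WordLimits.

(** * Gaussian words *)

Section GaussianSide.
Context (R : realType) (m : nat).
Local Notation C := R[i].
Local Notation "x %:C" := (real_complex R x) : ring_scope.
Context d (T : measurableType d) (P : probability T R) (U V : 'I_m -> {RV P >-> R}).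
Let Z (i : 'I_m) (b : bool) : T -> R := if b then (U i : T -> R) else (V i : T -> R).
Hypothesis Z_fam : indep_families P Z.
Hypothesis Z_RV : forall i, indep_RVs P (Z i).
Hypothesis U_law : forall i (B : set R), measurable B ->
  P (U i @^-1` B) = normal_prob 0 (Num.sqrt 2^-1) B.
Hypothesis V_law : forall i (B : set R), measurable B ->
  P (V i @^-1` B) = normal_prob 0 (Num.sqrt 2^-1) B.

Let mZ i b : measurable_fun setT (Z i b).
Proof. by rewrite /Z; case: b; exact: measurable_funP. Qed.

Let MZ i b : moments_le P (@gauss_abs_moment R) (Z i b).
Proof. by rewrite /Z; case: b; [exact: gauss_moments_le (U_law i)|exact: gauss_moments_le (V_law i)]. Qed.

Let Z_rec i b p : \int[P]_w (Z i b w ^+ p.+1) = p%:R / 2 * \int[P]_w (Z i b w ^+ p.-1).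
Proof. by rewrite /Z; case: b; [exact: gauss_moment_rec (U_law i) p|exact: gauss_moment_rec (V_law i) p]. Qed.

Definition gauss_word_sum (s : seq ('I_m * bool)) : C :=
  wsum (@zgauss R) (fun q => (mixed_moment P Z q)%:C) s.

Lemma gauss_word_sum_nil : gauss_word_sum [::] = 1.
Proof. by rewrite /gauss_word_sum /= mixed_moment_nil. Qed.

(** The moment recursion cancels the factor in [wick_errorE], so the Wick formula holds without
    defect. *)
Lemma gauss_word_sum_rec x s : gauss_word_sum (x :: s) =
  \sum_(y <- splits s | y.1.1 == x.1) (x.2 != y.1.2)%:R * gauss_word_sum y.2.
Proof.
have G_perm (q q' : seq ('I_m * bool)) : perm_eq q q' ->
    mixed_moment P Z q = mixed_moment P Z q'.
  by move=> qq; congr Rintegral; apply/funext => w; exact: perm_big.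
have G_split a q := mixed_moment_split mZ Z_fam Z_RV MZ a q.
have err0 q : wick_error (mixed_moment P Z) 2^-1 q = 0.
  case: q => [//|a q].
  rewrite (wick_errorE (mu := fun a p => \int[P]_w (Z a.1 a.2 w ^+ p)) G_perm G_split).
  by rewrite Z_rec [_ / 2]mulrC subrr mul0r.
(* The zero defect is written as a product so that [wsumZ] shows its weighted sum to be 0. *)
rewrite /gauss_word_sum (wsum_wick (v := 2^-1) _ (E := fun q => 0 * 0)).
  rewrite (@wsumZ _ _ _ _ 0 (fun=> 0)) mul0r addr0.
  by apply: eq_bigr => y _; rewrite zgauss_pair.
move=> a q /=; have /eqP := err0 (a :: q); rewrite subr_eq0 => /eqP ->.
by rewrite mul0r addr0 -rmorph_sum rmorphM /= fmorphV rmorph_nat.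
Qed.

Lemma gauss_trace_expect s :
  let tr w := \tr (word_mx (fun i => amat (fun w => Complex (U i w) (V i w)) w) s) in
  cintegrable P tr /\
  Ec P tr = \sum_b (~~ odd (size s))%:R * gauss_word_sum (alt b s).
Proof.
move=> tr.
have -> : tr = fun w => \sum_b (~~ odd (size s))%:R *
    \prod_(x <- alt b s) \sum_c zgauss R x.2 c * (Z x.1 c w)%:C.
  apply/funext => w; rewrite /tr trace_amat_word; apply: eq_bigr => b _.
  congr (_ * _); apply: eq_bigr => x _; apply: eq_bigr => c _; congr (_ * _%:C).
  by rewrite /Z; case: c.
have H b := Ec_prod_wsum (@zgauss R) (alt b s) (fun a : 'I_m * bool => MZ a.1 a.2).
have [c1 ->] := @cintegrable_sum _ _ _ P _ (index_enum bool)
   (fun b => (~~ odd (size s))%:R) _ (fun b => (H b).1).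
by split=> //; apply: eq_bigr => b _; congr (_ * _); rewrite (H b).2.
Qed.

End GaussianSide.

Lemma cvgC_le_sqrt (R : realType) (u : nat -> R[i]) (l : R[i]) (Kh : R) :
  (forall n, `|u n.+1 - l| <= real_complex R (Kh * (Num.sqrt n.+1%:R)^-1)) -> cvgC u l.
Proof.
move=> ul; rewrite /cvgC -cvg_shiftS.
apply: (@squeeze_cvgr _ _ _ _ (fun=> 0) (fun n => Kh * Num.sqrt n.+1%:R^-1)).
- apply: nearW => n; move: (ul n); set z : R[i] := u n.+1 - l.
  rewrite -[ `|z| ]/(real_complex R (Normc.normc z)) lecR sqrtrV// => ->.
  by rewrite andbT -[leRHS]/(Normc.normc z); case: z => a b; exact: sqrtr_ge0.
- exact: cvg_cst.
rewrite -[X in _ --> X](mulr0 Kh) -(@sqrtr0 R); apply: cvgMl_tmp.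
apply: (cvg_comp (fun n => n.+1%:R^-1) Num.sqrt); first exact: cvg_harmonic.
exact: sqrt_continuous.
Qed.

(** Every order, also below 3, is covered by [|x| ^+ k <= 1 + |x| ^+ (k + 3)]; summing over the
    finite [I] makes the bound common to all families. *)
Lemma moments_le_uniform (R : realType) (I : finType) (J : Type) d (T : measurableType d)
    (P : probability T R) (X : I -> J -> T -> R) :
  (forall i j, measurable_fun setT (X i j)) ->
  (forall i (k : nat), (3 <= k)%N ->
     exists M : R, forall j, (\int[P]_w (`|X i j w| ^+ k)%:E <= M%:E)%E) ->
  exists M, forall i j, moments_le P M (X i j).
Proof.
move=> mX Xmom.
have /choice[M HM] : forall ik : I * nat, exists M : R, forall j,
    (\int[P]_w (`|X ik.1 j w| ^+ (ik.2 + 3))%:E <= M%:E)%E.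
  by move=> [i k]; apply: Xmom; rewrite leq_addl.
exists (fun k => 1 + \sum_i `|M (i, k)|) => i j; split=> // k.
have mp p : measurable_fun setT (fun w => (`|X i j w| ^+ p)%:E).
  by apply/measurable_EFinP/measurable_funX/measurableT_comp.
apply: (@le_trans _ _ (\int[P]_w (1%:E + (`|X i j w| ^+ (k + 3))%:E))%E).
  apply: ge0_le_integral => //.
  - by apply: emeasurable_funD.
  - move=> w _; rewrite -EFinD lee_fin.
    have [x1|x1] := leP `|X i j w| 1.
      by apply: ler_wpDr => //; exact: exprn_ile1.
    by apply: ler_wpDl => //; rewrite ler_weXn2l ?leq_addr// ltW.
rewrite ge0_integralD// integral_cst//= probability_setT mule1 EFinD leeD2l//.
apply: le_trans (HM (i, k) j) _; rewrite lee_fin.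
rewrite (bigD1 i)//=; apply: ler_wpDr; last exact: ler_norm.
by rewrite sumr_ge0.
Qed.

Unset Implicit Arguments.

Theorem theorem3 (R : realType) (m : nat) (hm : (0 < m)%N)
  (d : measure_display) (T : measurableType d) (P : probability T R)
  (X : 'I_m -> nat -> {RV P >-> R})
  (Xindep_fam : indep_families P (fun i j => (X i j : T -> R)))
  (Xindep : forall i, indep_RVs P (fun j => (X i j : T -> R)))
  (Xmean : forall i j, ('E_P[X i j] = 0)%E)
  (Xvar : forall i j, ('E_P[fun w => (X i j w ^+ 2)%R] = 1)%E)
  (Xmom : forall i (k : nat), (3 <= k)%N ->
     exists M : R, forall j, ('E_P[fun w => (`|X i j w| ^+ k)%R] <= M%:E)%E)
  (d' : measure_display) (T' : measurableType d') (P' : probability T' R)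
  (U V : 'I_m -> {RV P' >-> R})
  (UVindep_fam : indep_families P'
     (fun i (b : bool) => if b then (U i : T' -> R) else (V i : T' -> R)))
  (UVindep : forall i, indep_RVs P'
     (fun b : bool => if b then (U i : T' -> R) else (V i : T' -> R)))
  (Ulaw : forall i (B : set R), measurable B ->
     P' (U i @^-1` B) = normal_prob 0 (Num.sqrt (2^-1)) B)
  (Vlaw : forall i (B : set R), measurable B ->
     P' (V i @^-1` B) = normal_prob 0 (Num.sqrt (2^-1)) B)
  (Q : ncpoly R m) :
  let eta i := fun w => (U i w +i* V i w)%C in
  cvgC (fun n => phi P (nceval_rand Q (fun i => RCmat (fun j => X i j) n)))
       (phi P' (nceval_rand Q (fun i => amat (eta i)))).
Proof.
move=> eta.
have mX i j : measurable_fun setT (X i j : T -> R) by exact: measurable_funP.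
have [M MX] : exists M, forall i j, moments_le P M (X i j : T -> R).
  apply: moments_le_uniform => // i k k3; have [M HM] := Xmom i k k3.
  by exists M => j; have := HM j; rewrite unlock.
have X1 i j : \int[P]_w X i j w = 0.
  by have := Xmean i j; rewrite unlock /Rintegral => ->.
have X2 i j : \int[P]_w (X i j w ^+ 2) = 1.
  by have := Xvar i j; rewrite unlock /Rintegral => ->.
pose W := gauss_word_sum U V.
pose rcw n s := phi P (fun w => word_mx (fun i => RCmat (fun j => X i j) n w) s).
pose gw s := phi P' (fun w => word_mx (fun i => amat (eta i) w) s).
have word_cvg s : exists Kh : R, forall n,
    `|rcw n.+1 s - gw s| <= real_complex R (Kh * (Num.sqrt n.+1%:R)^-1).
  have H b := phi_rc_word_cvg mX Xindep_fam Xindep X1 X2 MX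
    (gauss_word_sum_nil U V) (@gauss_word_sum_rec _ _ _ _ P' U V UVindep_fam UVindep Ulaw Vlaw) b s.
  have [K1 _ H1] := H true; have [K2 _ H2] := H false.
  exists (2^-1 * (K1 + K2)) => n.
  (* The functional on two-by-two matrices averages over both starting vectors, while the reverse
     circulant side has the same limit estimate for either value of [b]. *)
  have -> : rcw n.+1 s - gw s = 2^-1 *
     ((rcw n.+1 s - (~~ odd (size s))%:R * W (alt true s)) +
      (rcw n.+1 s - (~~ odd (size s))%:R * W (alt false s))).
    rewrite /gw /phi (@gauss_trace_expect _ _ _ _ P' U V Ulaw Vlaw s).2 big_bool /=.
    rewrite -/W; set a := rcw _ _; set x := _ * W _; set y := _ * W _.
    by field.
  rewrite normrM normfV normr_nat -mulrA rmorphM /= fmorphV rmorph_nat.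
  rewrite ler_wpM2l ?invr_ge0//; apply: le_trans (ler_normD _ _) _.
  by rewrite mulrDl rmorphD; apply: lerD; [exact: H1|exact: H2].
have [Kh HK] : exists Kh : R, forall n,
    `|\sum_(t <- Q) t.1 * rcw n.+1 t.2 - \sum_(t <- Q) t.1 * gw t.2| <=
    real_complex R (Kh * (Num.sqrt n.+1%:R)^-1).
  elim: Q => [|t Q [K1 H1]].
    by exists 0 => n; rewrite !big_nil subrr normr0 mul0r.
  have [K2 H2] := word_cvg t.2.
  have [a aE] : exists a : R, real_complex R a = `|t.1|.
    by exists (complex.Re `|t.1|); rewrite RRe_real ?normr_real.
  exists (a * K2 + K1) => n.
  rewrite !big_cons opprD addrACA -mulrBr mulrDl rmorphD /=.
  apply: le_trans (ler_normD _ _) _; rewrite lerD// normrM -mulrA rmorphM /=.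
  by rewrite aE ler_wpM2l.
apply: (@cvgC_le_sqrt _ _ _ Kh) => n.
rewrite !phi_nceval_rand//.
- exact: HK.
- by move=> s; exact: (@gauss_trace_expect _ _ _ _ P' U V Ulaw Vlaw s).1.
move=> s; have [rs [urs rsN]] := unity_roots R (ltn0Sn n).
exact: (rc_trace_expect MX true s urs rsN).1.
Qed.
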